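(* Let $A$ be a Banach algebra, let $B$ be a Banach $A$-bimodule, and let $n\ge 2$ be an even number. Then: (1) If $e^{(n)}\in A^{(n)}$ is a right unit for $B^{(n)}$ and $Z^\ell_{e^{(n)}}(B^{(n)})=B^{(n)}$, then $A^{(n-2)}B^{(n-1)}=B^{(n-1)}$. (2) If $e^{(n)}\in A^{(n)}$ is a left unit for $B^{(n)}$ and $Z^r_{e^{(n)}}(B^{(n)})=B^{(n)}$, then $B^{(n-1)}A^{(n-2)}=B^{(n-1)}$. (3) If $e^{(n)}\in A^{(n)}$ is a right unit for $B^{(n)}$ and $\tilde Z^\ell_{e^{(n)}}(B^{(n)})=B^{(n)}$, then $A^{(n-2)}B^{(n-1)}=B^{(n-1)}$ and the weak* closure of $A^{(n-2)}B^{(n+1)}$ is $B^{(n+1)}$. (4) If $e^{(n)}\in A^{(n)}$ is a left unit for $B^{(n)}$ and $\tilde Z^r_{e^{(n)}}(B^{(n)})=B^{(n)}$, then $B^{(n-1)}A^{(n-2)}=B^{(n-1)}$ and the weak* closure of $B^{(n+1)}A^{(n-2)}$ is $B^{(n+1)}$.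
   Context: For a bounded bilinear map $m:X\times Y\to Z$ of normed spaces define $m^*:Z^*\times X\to Y^*$ by $\langle m^*(z',x),y\rangle=\langle z',m(x,y)\rangle$, $m^{**}=(m^* )^*:Y^{**}\times Z^*\to X^*$ and $m^{***}=(m^{**})^*:X^{**}\times Y^{**}\to Z^{**}$. The transpose is $m^t(y,x)=m(x,y)$, and $m^{t***}=(m^t)^{***}:Y^{**}\times X^{**}\to Z^{**}$. $A^{(k)},B^{(k)}$ denote the $k$-th duals, $A^{(0)}=A$, $B^{(0)}=B$. For even $k\ge2$, $A^{(k)}$ is a Banach algebra under the first Arens product, i.e. $m^{***}$ for $m$ the product of $A^{(k-2)}$, and $B^{(k)}$ is a Banach $A^{(k)}$-bimodule with left and right actions $m^{***}$ for $m$ the left and right actions of $A^{(k-2)}$ on $B^{(k-2)}$; actions are written by juxtaposition. For even $k\ge 0$, $B^{(k+1)}$ is the dual $A^{(k)}$-bimodule: $\langle ab',b\rangle=\langle b',ba\rangle$, $\langle b'a,b\rangle=\langle b',ab\rangle$ ($a\in A^{(k)}$, $b\in B^{(k)}$, $b'\in B^{(k+1)}$). Spaces are identified with their canonical images in second duals (so $A^{(n-2)}\subseteq A^{(n)}$ acts on $B^{(n+1)}$). Products of sets denote sets of all products. $e\in A^{(n)}$ is a right (left) unit for $B^{(n)}$ if it is a right (left) unit element of the algebra $A^{(n)}$ and $be=b$ ($eb=b$) for all $b\in B^{(n)}$. A map $f$ defined on $A^{(n)}$ is weak*-to-$\tau$ point continuous at $e$ if for every net $(a_\alpha)$ in $A^{(n)}$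 with $a_\alpha\to e$ weak* one has $f(a_\alpha)\to f(e)$ in the topology $\tau$. Let $\pi_\ell$ be the left action $A^{(n-2)}\times B^{(n-2)}\to B^{(n-2)}$. For $e\in A^{(n)}$: - $Z^\ell_e(B^{(n)})$ is the set of $b\in B^{(n)}$ such that $a\mapsto ba$ is weak*-to-weak* point continuous at $e$; - $Z^r_e(B^{(n)})$ is the set of $b\in B^{(n)}$ such that $a\mapsto\pi_\ell^{t***}(b,a)$ is weak*-to-weak* point continuous at $e$; - $\tilde Z^\ell_e(B^{(n)})$ is the set of $b\in B^{(n)}$ such that $a\mapsto ba$ is weak*-to-weak point continuous at $e$; - $\tilde Z^r_e(B^{(n)})$ is the set of $b\in B^{(n)}$ such that $a\mapsto ab$ is weak*-to-weak point continuous at $e$. Weak* topologies on duals are with respect to the obvious preduals. *)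

(* Defs.v *)
From HB Require Import structures.
From mathcomp Require Import all_boot all_order all_algebra.
From mathcomp Require Import sesquilinear.
From mathcomp Require Import boolp classical_sets functions reals topology.
From mathcomp Require Import normedtype.
From mathcomp Require Import complex.

Set Implicit Arguments.
Unset Strict Implicit.
Unset Printing Implicit Defensive.

Import Order.TTheory GRing.Theory Num.Theory.
Import numFieldNormedType.Exports.

Local Open Scope classical_set_scope.
Local Open Scope ring_scope.

(* Banach algebras and modules are treated simultaneously over the real field R
   and over its complexification R[i]. *)
Variant scalar_kind := RealScalars | ComplexScalars.

Definition scalars (R : realType) (c : scalar_kind) : numFieldType :=
  match c with RealScalars => R | ComplexScalars => R[i] end.

Definition scalar_re (R : realType) (c : scalar_kind) : scalars R c -> R :=
  match c with RealScalars => fun x => x | ComplexScalars => @complex.Re R end.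

Definition scalar_of (R : realType) (c : scalar_kind) : R -> scalars R c :=
  match c with
  | RealScalars => fun x => x
  | ComplexScalars => @real_complex R
  end.
Arguments scalar_of {R} c.

Section Scalars.
Context {R : realType} {c : scalar_kind}.
Local Notation K := (scalars R c).

Lemma scalar_ofK : cancel (@scalar_of R c) (@scalar_re R c).
Proof. by case: c. Qed.

Lemma ler_scalar_of (x y : R) : (scalar_of c x <= scalar_of c y) = (x <= y).
Proof. by case: c => //; exact: lecR. Qed.

Lemma ler_scalar_re (x y : K) : x <= y -> scalar_re x <= scalar_re y.
Proof.
by move: x y; case: c => //= -[a b] [a' b'] /andP[].
Qed.

Lemma scalar_reK (x : K) : 0 <= x -> scalar_of c (scalar_re x) = x.
Proof. by move: x; case: c => //= -[a b] /andP[/eqP /= ->]. Qed.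

End Scalars.

Section Dual.
Context {R : realType} {c : scalar_kind}.
Local Notation K := (scalars R c).
Variable X : normedModType K.

Definition is_dual : {pred X -> K^o} :=
  fun f => `[< linear f /\ continuous f >].

Lemma is_dual_submod : submod_closed is_dual.
Proof.
split=> [|a f g].
  apply/asboolP; split; last by move=> x; exact: cvg_cst.
  by move=> a x y; rewrite scaler0 addr0.
move=> /asboolP[fl fc] /asboolP[gl gc]; apply/asboolP; split.
  move=> b x y; rewrite !fctE fl gl.
  by rewrite !scalerDr scalerA mulrC -scalerA addrACA.
move=> x; apply: cvgD; last exact: gc.
exact: (cvgZl_tmp (fc x)).
Qed.

HB.instance Definition _ := GRing.isSubmodClosed.Build _ _ is_dual
  is_dual_submod.

Record dual := Dual { dual_fun :> X -> K^o; dual_funP : dual_fun \in is_dual }.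

HB.instance Definition _ := [isSub for dual_fun].
HB.instance Definition _ := [Choice of dual by <:].
HB.instance Definition _ := [SubChoice_isSubLmodule of dual by <:].

Lemma dual_linear (f : dual) : linear f.
Proof. by have /asboolP[] := dual_funP f. Qed.

Lemma dual_continuous (f : dual) : continuous f.
Proof. by have /asboolP[] := dual_funP f. Qed.

HB.instance Definition _ (f : dual) :=
  GRing.isLinear.Build K X K^o *:%R f (dual_linear f).

Lemma dual_ext (f g : dual) : f =1 g -> f = g.
Proof. by move=> fg; apply/val_inj/funext. Qed.

(* The norm of a space over K takes its values in K, so the supremum is taken in
   R and mapped back to K. *)
Definition dual_norm (f : dual) : K :=
  scalar_of c (sup [set scalar_re `|f x| | x in [set x : X | `|x| <= 1]]).

Lemma dual_bounded (f : dual) : exists2 M, 0 <= M & forall x, `|f x| <= M * `|x|.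
Proof.
have /linear_bounded_continuous/linear_boundedP := @dual_continuous f.
by move=> /pinfty_ex_gt0[M /ltW M0 fM]; exists M.
Qed.

Let dset_has_sup (f : dual) :
  has_sup [set scalar_re `|f x| | x in [set x : X | `|x| <= 1]].
Proof.
split; first by exists (scalar_re `|f 0|), 0 => //=; rewrite normr0 ler01.
have [M M0 fM] := dual_bounded f.
exists (scalar_re M) => _ [x /= x1 <-]; apply: ler_scalar_re.
by apply: (le_trans (fM x)); rewrite ler_piMr.
Qed.

Lemma dual_norm_ge0 (f : dual) : 0 <= dual_norm f.
Proof.
have -> : (0 : K) = scalar_of c 0 by case: c.
rewrite ler_scalar_of.
apply: (@le_trans _ _ (scalar_re `|f 0|)).
  by rewrite linear0 normr0; case: c.
apply: ub_le_sup; first by case: (dset_has_sup f).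
by exists 0 => //=; rewrite normr0 ler01.
Qed.

Lemma le_dual_norm (f : dual) (x : X) : `|f x| <= dual_norm f * `|x|.
Proof.
have [->|x0] := eqVneq x 0; first by rewrite linear0 !normr0 mulr0.
have nx0 : 0 < `|x| by rewrite normr_gt0.
rewrite -ler_pdivrMr//.
have -> : `|f x| / `|x| = `|f (`|x|^-1 *: x)|.
  by rewrite linearZ normrZ normfV normr_id mulrC.
rewrite -[leLHS]scalar_reK// ler_scalar_of.
apply: ub_le_sup; first by case: (dset_has_sup f).
by exists (`|x|^-1 *: x) => //=; rewrite normrZ normfV normr_id mulVf ?gt_eqF.
Qed.

Lemma dual_norm_le (f : dual) (M : K) :
  0 <= M -> (forall x, `|f x| <= M * `|x|) -> dual_norm f <= M.
Proof.
move=> M0 fM; rewrite -(scalar_reK M0) ler_scalar_of.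
apply: ge_sup; first by case: (dset_has_sup f).
move=> _ [x /= x1 <-]; apply: ler_scalar_re.
by apply: (le_trans (fM x)); rewrite ler_piMr.
Qed.

Let dual_normD (f g : dual) : dual_norm (f + g) <= dual_norm f + dual_norm g.
Proof.
apply: dual_norm_le; first by rewrite addr_ge0 ?dual_norm_ge0.
move=> x; rewrite mulrDl (le_trans (ler_normD (f x) (g x)))//.
by rewrite lerD ?le_dual_norm.
Qed.

Let dual_normZ (a : K) (f : dual) : dual_norm (a *: f) = `|a| * dual_norm f.
Proof.
have le_normZ b (g : dual) : dual_norm (b *: g) <= `|b| * dual_norm g.
  apply: dual_norm_le => [|x]; first by rewrite mulr_ge0 ?dual_norm_ge0.
  have -> : (b *: g) x = b *: g x by [].
  by rewrite normrZ -mulrA ler_wpM2l ?le_dual_norm.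
apply/eqP; rewrite eq_le le_normZ/=; have [->|a0] := eqVneq a 0.
  by rewrite normr0 mul0r dual_norm_ge0.
rewrite -ler_pdivlMl ?normr_gt0// -normfV -[X in dual_norm X <= _]scale1r.
by rewrite -(mulVf a0) -scalerA le_normZ.
Qed.

Let dual_norm0_eq0 (f : dual) : dual_norm f = 0 -> f = 0.
Proof.
move=> f0; apply: dual_ext => x; apply/eqP; rewrite -normr_le0.
by rewrite (le_trans (le_dual_norm f x))// f0 mul0r.
Qed.

HB.instance Definition _ := Lmodule_isNormed.Build K dual
  dual_normD dual_normZ dual_norm0_eq0.


Lemma ler_dual_norm (f : dual) (x : X) : `|f x| <= `|f| * `|x|.
Proof. exact: le_dual_norm. Qed.

Lemma dual_norm_ler (f : dual) (M : K) :
  0 <= M -> (forall x, `|f x| <= M * `|x|) -> `|f| <= M.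
Proof. exact: dual_norm_le. Qed.

Lemma is_dual_bounded (f : X -> K^o) (M : K) : 0 <= M ->
  linear f -> (forall x, `|f x| <= M * `|x|) -> f \in is_dual.
Proof.
move=> M0 fl fM; apply/asboolP; split=> //.
pose h := GRing.isLinear.Build K X K^o *:%R f fl.
pose g : {linear X -> K^o} := HB.pack f h.
apply: (@linear_bounded_continuous _ _ _ g).1; apply/linear_boundedP.
exists M; split; first exact: ger0_real.
by move=> r /ltW Mr x; rewrite (le_trans (fM x))// ler_wpM2r.
Qed.

End Dual.
Arguments is_dual {R c} X _.
Arguments dual {R c} X.
Arguments dual_ext {R c X} f g.

Fixpoint iter_dual (R : realType) (c : scalar_kind) (k : nat)
    (X : normedModType (scalars R c)) : normedModType (scalars R c) :=
  if k is k'.+1 then dual (iter_dual k' X) else X.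
Arguments iter_dual {R c} k X.

Section BoundedBilinear.
Context {R : realType} {c : scalar_kind}.
Local Notation K := (scalars R c).
Implicit Types X Y Z : normedModType K.

Record bbilinear X Y Z := BBilinear {
  bbil_fun :> X -> Y -> Z;
  bbil_bilinear : bilinear_for *:%R *:%R bbil_fun;
  bbil_bounded : exists2 M : K, 0 <= M &
    forall x y, `|bbil_fun x y| <= M * `|x| * `|y| }.

Program Definition transpose X Y Z (m : bbilinear X Y Z) : bbilinear Y X Z :=
  @BBilinear Y X Z (fun y x => m x y) _ _.
Next Obligation.
move=> X Y Z m; have [ml mr] := bbil_bilinear m.
by split=> ? a u v /=; [exact: mr|exact: ml].
Qed.
Next Obligation.
move=> X Y Z m; have [M M0 mM] := bbil_bounded m.
by exists M => // x y; rewrite mulrAC.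
Qed.

Lemma adjoint_subproof X Y Z (m : bbilinear X Y Z) (z' : dual Z) (x : X) :
  (fun y => z' (m x y)) \in is_dual Y.
Proof.
have [ml mr] := bbil_bilinear m; have [M M0 mM] := bbil_bounded m.
apply: (@is_dual_bounded _ _ _ _ (`|z'| * (M * `|x|))).
- by rewrite !mulr_ge0.
- by move=> a u v; rewrite mr linearP.
- move=> y; rewrite (le_trans (ler_dual_norm _ _))// -mulrA.
  by rewrite ler_wpM2l.
Qed.

(* m^*, see adjointE. *)
Program Definition adjoint X Y Z (m : bbilinear X Y Z) :
    bbilinear (dual Z) X (dual Y) :=
  @BBilinear (dual Z) X (dual Y) (fun z' x => Dual (adjoint_subproof m z' x))
    _ _.
Next Obligation.
move=> X Y Z m; have [ml mr] := bbil_bilinear m; split=> [x|z'] a u v.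
  exact: dual_ext.
by apply: dual_ext => y /=; rewrite ml linearP.
Qed.
Next Obligation.
move=> X Y Z m; have [M M0 mM] := bbil_bounded m.
exists M => // z' x; apply: dual_norm_ler => [|y /=]; first by rewrite !mulr_ge0.
rewrite (le_trans (ler_dual_norm _ _))// -[M * _]mulrC -!mulrA.
by rewrite ler_wpM2l// mulrA.
Qed.

Definition adjoint3 X Y Z (m : bbilinear X Y Z) :
    bbilinear (dual (dual X)) (dual (dual Y)) (dual (dual Z)) :=
  adjoint (adjoint (adjoint m)).

Lemma adjointE X Y Z (m : bbilinear X Y Z) (z' : dual Z) x y :
  adjoint m z' x y = z' (m x y).
Proof. by []. Qed.

Lemma bidual_embed_subproof X (x : X) :
  (fun f : dual X => f x) \in is_dual (dual X).
Proof.
apply: (@is_dual_bounded _ _ _ _ `|x|) => // f.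
by rewrite mulrC ler_dual_norm.
Qed.

Definition bidual_embed X (x : X) : dual (dual X) :=
  Dual (bidual_embed_subproof x).

End BoundedBilinear.

Section WeakTopologies.
Context {R : realType} {c : scalar_kind}.
Local Notation K := (scalars R c).
Variable X : normedModType K.

(* Initial topologies for evaluation, the function space carrying the topology of
   pointwise convergence. *)
Definition weak : topologicalType :=
  initial_topology (fun x : X => (fun f : dual X => f x) : {ptws dual X -> K^o}).

Definition weak_star : topologicalType :=
  initial_topology (fun f : dual X => (f : X -> K^o) : {ptws X -> K^o}).

End WeakTopologies.

Section Nets.

Record directed (I : Type) (le : I -> I -> Prop) : Prop := Directed {
  directed_inhabited : inhabited I;
  directed_refl : forall i, le i i;
  directed_trans : forall i j k, le i j -> le j k -> le i k;
  directed_ub : forall i j, exists2 k, le i k & le j k }.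

Definition net_filter (I T : Type) (le : I -> I -> Prop) (a : I -> T) :
    set_system T :=
  [set S | exists i, forall j, le i j -> S (a j)].

Definition point_continuous (T U : topologicalType) (f : T -> U) (e : T) :=
  forall (I : Type) (le : I -> I -> Prop) (a : I -> T), directed le ->
    net_filter le a --> e -> net_filter le (f \o a) --> f e.

Lemma point_continuousP (T U : topologicalType) (f : T -> U) (e : T) :
  point_continuous f e <-> {for e, continuous f}.
Proof.
split=> [fe | fe I le a _ ae S /fe /ae [i ai]]; last by exists i.
pose I := {p : set T * T | nbhs e p.1 /\ p.1 p.2}.
pose le (p q : I) := (sval q).1 `<=` (sval p).1.
have IP S : nbhs e S -> exists p : I, (sval p).1 = S.
  move=> eS; have Se := nbhs_singleton eS.
  by exists (exist _ (S, e) (conj eS Se)).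
have dir : directed le.
  split; first by have [p _] := IP _ (filterT : nbhs e setT).
  - by move=> p.
  - by move=> p q r pq qr; exact: subset_trans qr pq.
  - move=> p q; have [[eS _] [eS' _]] := (svalP p, svalP q).
    have [r rE] := IP _ (filterI eS eS').
    by exists r; rewrite /le rE; [exact: subIsetl|exact: subIsetr].
move=> S Sfe; have := fe I le (fun p => (sval p).2) dir.
case/(_ _ S Sfe) => [S' eS'|p pS].
  have [p pE] := IP _ eS'; exists p => q; rewrite /le pE.
  by apply; exact: (svalP q).2.
have [ep _] := svalP p; apply: filterS ep => t pt.
exact: (pS (exist _ ((sval p).1, t) (conj (svalP p).1 pt))).
Qed.

End Nets.

Record banachAlgebra (R : realType) (c : scalar_kind) := BanachAlgebra {
  balg_sort :> completeNormedModType (scalars R c);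
  balg_mul : bbilinear balg_sort balg_sort balg_sort;
  balg_mulA : associative balg_mul;
  balg_normM : forall a b, `|balg_mul a b| <= `|a| * `|b| }.
Arguments balg_mul {R c} A : rename.

(* The actions are only required to be bounded, not contractive. *)
Record banachBimodule (R : realType) (c : scalar_kind)
    (A : banachAlgebra R c) := BanachBimodule {
  bbim_sort :> completeNormedModType (scalars R c);
  bbim_left : bbilinear A bbim_sort bbim_sort;
  bbim_right : bbilinear bbim_sort A bbim_sort;
  bbim_leftA : forall a a' b,
    bbim_left (balg_mul A a a') b = bbim_left a (bbim_left a' b);
  bbim_rightA : forall b a a',
    bbim_right b (balg_mul A a a') = bbim_right (bbim_right b a) a';
  bbim_leftrightA : forall a b a',
    bbim_right (bbim_left a b) a' = bbim_left a (bbim_right b a') }.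
Arguments bbim_left {R c A} B : rename.
Arguments bbim_right {R c A} B : rename.

(* The even duals are indexed by half their order. k.+1.*2 reduces to k.*2.+2,
   so that iter_dual k.+1.*2 X is convertible to dual (dual (iter_dual k.*2 X)). *)
Definition even_embed (R : realType) (c : scalar_kind)
    (X : normedModType (scalars R c)) (k : nat) :
    iter_dual k.*2 X -> iter_dual k.+1.*2 X :=
  @bidual_embed R c (iter_dual k.*2 X).

Section EvenDuals.
Context {R : realType} {c : scalar_kind} (A : banachAlgebra R c).

Fixpoint arens_mul (k : nat) :
    bbilinear (iter_dual k.*2 A) (iter_dual k.*2 A) (iter_dual k.*2 A) :=
  if k is k'.+1 then adjoint3 (arens_mul k') else balg_mul A.

Variable B : banachBimodule A.

Fixpoint left_act (k : nat) :
    bbilinear (iter_dual k.*2 A) (iter_dual k.*2 B) (iter_dual k.*2 B) :=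
  if k is k'.+1 then adjoint3 (left_act k') else bbim_left B.

Fixpoint right_act (k : nat) :
    bbilinear (iter_dual k.*2 B) (iter_dual k.*2 A) (iter_dual k.*2 B) :=
  if k is k'.+1 then adjoint3 (right_act k') else bbim_right B.

Definition dual_left_act (k : nat) :
    bbilinear (iter_dual k.*2 A) (iter_dual k.*2.+1 B) (iter_dual k.*2.+1 B) :=
  transpose (adjoint (transpose (right_act k))).

Definition dual_right_act (k : nat) :
    bbilinear (iter_dual k.*2.+1 B) (iter_dual k.*2 A) (iter_dual k.*2.+1 B) :=
  adjoint (left_act k).

Lemma dual_left_actE k a b' b :
  dual_left_act k a b' b = b' (right_act k b a).
Proof. by []. Qed.

Lemma dual_right_actE k b' a b :
  dual_right_act k b' a b = b' (left_act k a b).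
Proof. by []. Qed.

Definition right_unit (k : nat) (e : iter_dual k.*2 A) : Prop :=
  (forall a, arens_mul k a e = a) /\ (forall b, right_act k b e = b).

Definition left_unit (k : nat) (e : iter_dual k.*2 A) : Prop :=
  (forall a, arens_mul k e a = a) /\ (forall b, left_act k e b = b).

(* With n = k.+1.*2, the predual of A^(n) is iter_dual k.*2.+1 A. *)
Section Centers.
Variables (k : nat) (e : iter_dual k.+1.*2 A).

Definition Zl : set (iter_dual k.+1.*2 B) :=
  [set b | @point_continuous
             (weak_star (iter_dual k.*2.+1 A)) (weak_star (iter_dual k.*2.+1 B))
             (fun a => right_act k.+1 b a) e].

(* Here a |-> pi_l^{t***}(b, a), which need not be a |-> ab. *)
Definition Zr : set (iter_dual k.+1.*2 B) :=
  [set b | @point_continuous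
             (weak_star (iter_dual k.*2.+1 A)) (weak_star (iter_dual k.*2.+1 B))
             (fun a => adjoint3 (transpose (left_act k)) b a) e].

Definition Zl_tilde : set (iter_dual k.+1.*2 B) :=
  [set b | @point_continuous
             (weak_star (iter_dual k.*2.+1 A)) (weak (iter_dual k.+1.*2 B))
             (fun a => right_act k.+1 b a) e].

Definition Zr_tilde : set (iter_dual k.+1.*2 B) :=
  [set b | @point_continuous
             (weak_star (iter_dual k.*2.+1 A)) (weak (iter_dual k.+1.*2 B))
             (fun a => left_act k.+1 a b) e].

End Centers.

End EvenDuals.

Arguments right_unit {R c A} B k e.
Arguments left_unit {R c A} B k e.
Arguments Zl {R c A} B k e.
Arguments Zr {R c A} B k e.
Arguments Zl_tilde {R c A} B k e.
Arguments Zr_tilde {R c A} B k e.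
Arguments dual_left_act {R c A} B k.
Arguments dual_right_act {R c A} B k.

(* Main.v *)
Require Import Defs.
From mathcomp Require Import all_boot all_order all_algebra.
From mathcomp Require Import boolp classical_sets functions reals topology.
From mathcomp Require Import normedtype sequences.
From HB Require Import structures.
From mathcomp Require Import sesquilinear complex ring lra prodnormedzmodule.

Set Implicit Arguments.
Unset Strict Implicit.
Unset Printing Implicit Defensive.

Import Order.TTheory GRing.Theory Num.Theory.
Import numFieldNormedType.Exports.

Local Open Scope classical_set_scope.
Local Open Scope ring_scope.

(** In each part, the unit [e] of the bidual is turned into bounded
    approximate units in the algebra [A0], the even dual two orders below that
    of [e]; a factorization theorem of Cohen's type then gives the first
    claims. The space [X], the dual of the corresponding even dual of the
    module, is a module over [A0]; write it on the left.

    Weak form. Each [e] in the bidual is a weak* limit along a filter on [A0]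
    ([exists_interpolating_filter]). The hypotheses on [e] say, for functionals
    [F] on [A0] and [G] on [X], that [e (a |-> F (s a)) = F s] and
    [e (a |-> G (a y)) = G y]; the second identity comes from the continuity at
    [e] of [a |-> b a] for a right unit ([Zl_right_unit_act]), and from the
    first Arens product for a left unit ([left_unit_bidual]).

    From weak to norm. The Hahn-Banach theorem for a suitable seminorm
    ([helly]) gives, for all [s], [y] and [d > 0], a single [a] in [A0] of norm
    at most [`|e| + 1] with both [`|y - a y| <= d] and [`|s - s a| <= d]
    ([bounded_approximate_unit]).

    Factorization. The elements [a] approximate a left unit on the module but a
    right unit on the algebra, whereas Cohen's theorem is usually stated for a
    left approximate unit of the algebra. His argument adapts: [x = T_n y_n]
    with [T_n y = s_n y + q^n y], and for [U y = y - c (y - a y)] one has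
    [T_(n+1) = T_n U + c (s_n - s_n a)], so a right approximate unit is what
    keeps [T_(n+1)] solvable, with a bound known before [a] is chosen; then
    [a y_n] close to [y_n] keeps [y_(n+1)] close to [y_n] ([cohen_step]). In the
    limit [x = s y]. For right modules everything is applied to the opposite
    algebra.

    The density statements are direct: along the filter, [b a] tends weakly to
    [b e = b], so [a b'] tends weak* to [b'] ([dual_left_act_dense],
    [dual_right_act_dense]).

    Hahn-Banach and factorization are proved over the reals, and real and
    complex spaces are handled together through [realify]. *)

(** * Sublinear functionals and the Hahn-Banach theorem *)

Section Sublinear.
Context {R : realType} {V : lmodType R}.
Implicit Types (p q f : V -> R) (x y : V).

Definition sublinear p :=
  (forall x y, p (x + y) <= p x + p y) /\
  (forall r x, 0 < r -> p (r *: x) = r * p x).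

Lemma sublinear0 p : sublinear p -> p 0 = 0.
Proof.
by move=> [_ pZ]; have := pZ 2 0 ltac:(lra); rewrite scaler0; lra.
Qed.

Lemma sublinear_ge p x : sublinear p -> - p (- x) <= p x.
Proof.
move=> ps; have [pD _] := ps.
by have := pD x (- x); rewrite subrr sublinear0//; lra.
Qed.

(** The hypotheses on [F] allow a different member of the family to witness each
    sum and each multiple; they cover both chains and the family of
    [slide]. *)
Lemma sublinear_inf (F : set (V -> R)) (b : V -> R) : F !=set0 ->
    (forall f x, F f -> b x <= f x) ->
    (forall f g x y, F f -> F g -> exists2 h, F h & h (x + y) <= f x + g y) ->
    (forall r f x, 0 < r -> F f -> exists2 h, F h & h (r *: x) <= r * f x) ->
  sublinear (fun x => inf [set f x | f in F]).
Proof.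
move=> [f0 Ff0] Fb FD FZ; set q := fun x => _.
have q_le f x : F f -> q x <= f x.
  move=> Ff; apply: ge_inf; last by exists f.
  by exists (b x) => _ [g Fg <-]; exact: Fb.
have le_q c x : (forall f, F f -> c <= f x) -> c <= q x.
  move=> cF; apply: lb_le_inf; first by exists (f0 x), f0.
  by move=> _ [f Ff <-]; exact: cF.
have qZ r x : 0 < r -> q (r *: x) <= r * q x.
  move=> r0; rewrite -ler_pdivrMl//; apply: (le_q) => f Ff.
  have [h Fh hf] := FZ r f x r0 Ff.
  by rewrite ler_pdivrMl// (le_trans _ hf)// q_le.
split=> [x y|r x r0].
  rewrite -lerBlDr; apply: (le_q) => f Ff; rewrite lerBlDl -lerBlDr.
  apply: (le_q) => g Fg; rewrite lerBlDl.
  have [h Fh hf] := FD f g x y Ff Fg.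
  exact: le_trans (q_le _ _ Fh) hf.
apply/eqP; rewrite eq_le qZ//= -ler_pdivlMl//.
rewrite -[X in q X <= _]scale1r -(mulVf (lt0r_neq0 r0)) -scalerA.
by rewrite qZ ?invr_gt0.
Qed.

(** Sliding [p] along the ray spanned by [t]: this is the largest sublinear
    functional below [p] whose value at [- t] is at most [- p t]. *)
Definition slide p (t : V) : V -> R := fun x =>
  inf [set f x | f in
    [set (fun x => p (x + s *: t) - s * p t) | s in [set s | 0 <= s]]].

Lemma slideP p t : sublinear p ->
  [/\ sublinear (slide p t), forall x, slide p t x <= p x
    & slide p t (- t) <= - p t].
Proof.
move=> ps; have [pD pZ] := ps.
have pZ0 r x : 0 <= r -> p (r *: x) = r * p x.
  by rewrite le_eqVlt => /predU1P[<-|/pZ//]; rewrite scale0r mul0r sublinear0.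
pose b x := - p (- x).
have lb s x : 0 <= s -> b x <= p (x + s *: t) - s * p t.
  move=> s0; have := pD (x + s *: t) (- x).
  by rewrite addrAC subrr add0r pZ0// /b; lra.
have le s x : 0 <= s -> slide p t x <= p (x + s *: t) - s * p t.
  move=> s0; apply: ge_inf.
    by exists (b x) => _ [_ [r /= r0 <-] <-]; exact: lb.
  by exists (fun x => p (x + s *: t) - s * p t) => //; exists s.
split.
- apply: (sublinear_inf (b := b)).
  + by exists (fun x => p (x + 0 *: t) - 0 * p t), 0 => /=.
  + by move=> _ x [s s0 <-]; exact: lb.
  + move=> _ _ x y [s /= s0 <-] [s' /= s0' <-].
    exists (fun x => p (x + (s + s') *: t) - (s + s') * p t).
      by exists (s + s') => //=; exact: addr_ge0.
    by rewrite scalerDl addrACA; have := pD (x + s *: t) (y + s' *: t); lra.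
  + move=> r _ x r0 [s /= s0 <-].
    exists (fun x => p (x + (r * s) *: t) - (r * s) * p t).
      by exists (r * s) => //=; rewrite mulr_ge0// ltW.
    by rewrite -scalerA -scalerDr pZ// mulrBr mulrA.
- by move=> x; have := le 0 x (lexx _); rewrite scale0r addr0 mul0r subr0.
- have := le 1 (- t) ler01.
  by rewrite scale1r addNr sublinear0// mul1r sub0r.
Qed.

(** A sublinear functional below which there is no other one is odd, by
    sliding; an odd sublinear functional is linear. *)
Lemma minimal_sublinear_linear f : sublinear f ->
  (forall g, sublinear g -> (forall x, g x <= f x) -> g = f) ->
  linear (f : V -> R^o).
Proof.
move=> fs fmin; have [fD fZ] := fs.
have fN x : f (- x) = - f x.
  have [ss sf sN] := slideP x fs; rewrite (fmin _ ss sf) in sN.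
  by apply/eqP; rewrite eq_le sN; have := sublinear_ge (- x) fs; rewrite opprK.
have f_add x y : f (x + y) = f x + f y.
  apply/eqP; rewrite eq_le fD/=.
  by have := fD (- x) (- y); rewrite -opprD !fN; lra.
move=> r x y; rewrite f_add; congr (_ + _).
have [r0|r0|->] := ltgtP r 0; [|exact: fZ|by rewrite !scale0r sublinear0].
have := fZ (- r) x ltac:(lra); rewrite scaleNr fN mulNr => /oppr_inj //.
Qed.

(** Zorn's lemma: a chain below [p] has a pointwise infimum because
    [- p (- x)] bounds every sublinear functional below [p] from below. *)
Lemma exists_minimal_sublinear p : sublinear p ->
  exists f, [/\ sublinear f, forall x, f x <= p x
    & forall g, sublinear g -> (forall x, g x <= f x) -> g = f].
Proof.
move=> ps; pose T := {f | sublinear f /\ forall x, f x <= p x}.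
pose p0 : T := exist _ p (conj ps (fun x => lexx _)).
pose le (f g : T) := `[< forall x, sval g x <= sval f x >].
have [||||f fmin] := @Zorn T le.
- by move=> f; apply/asboolP.
- move=> f g h /asboolP fg /asboolP gh; apply/asboolP => x.
  exact: le_trans (gh x) (fg x).
- move=> [f Hf] [g Hg] /asboolP /= fg /asboolP /= gf.
  have E : f = g by apply/funext => x; apply/eqP; rewrite eq_le fg gf.
  by move: Hf; rewrite E => Hf; rewrite (Prop_irrelevance Hf Hg).
- move=> A Atot; have [->|/set0P[g0 Ag0]] := eqVneq A set0; first by exists p0.
  pose F := [set sval g | g in A].
  have lb f x : F f -> - p (- x) <= f x.
    move=> [g _ <-]; have [gs gp] := svalP g.
    by rewrite (le_trans _ (sublinear_ge _ gs))// lerN2.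
  have q_le f x : F f -> inf [set h x | h in F] <= f x.
    move=> Ff; apply: ge_inf; last by exists f.
    by exists (- p (- x)) => _ [h Fh <-]; exact: lb.
  have qs : sublinear (fun x => inf [set f x | f in F]).
    apply: (sublinear_inf (b := fun x => - p (- x))) => //.
    + by exists (sval g0), g0.
    + move=> _ _ x y [g Ag <-] [h Ah <-].
      have [[gD _] _] := svalP g; have [[hD _] _] := svalP h.
      have [/asboolP gh|/asboolP hg] := Atot _ _ Ag Ah.
        by exists (sval h); [exists h|rewrite (le_trans (hD x y))// lerD2r].
      by exists (sval g); [exists g|rewrite (le_trans (gD x y))// lerD2l].
    + move=> r _ x r0 [g Ag <-]; have [[_ gZ] _] := svalP g.
      by exists (sval g); [exists g|rewrite gZ].
  have qp x : inf [set f x | f in F] <= p x.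
    by apply: (le_trans _ ((svalP g0).2 x)); apply: (q_le); exists g0.
  exists (exist (fun f => sublinear f /\ forall x, f x <= p x) _ (conj qs qp)).
  move=> g Ag; apply/asboolP => x /=.
  by apply: (q_le); exists g.
have [fs fp] := svalP f; exists (sval f); split=> // g gs gf.
have gp x : g x <= p x by exact: le_trans (gf x) (fp x).
by rewrite -(fmin (exist _ g (conj gs gp)))//; exact/asboolP.
Qed.

(** A minimal sublinear functional below [slide p t] is linear, and its value at
    [- t] is at most [- p t]. *)
Theorem hahn_banach p (t : V) : sublinear p ->
  exists f, [/\ linear (f : V -> R^o), forall x, f x <= p x & f t = p t].
Proof.
move=> ps; have [ss sp sN] := slideP t ps.
have [f [fs fp fmin]] := exists_minimal_sublinear ss.
have fl := minimal_sublinear_linear fs fmin.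
exists f; split=> //; first by move=> x; exact: le_trans (fp x) (sp x).
apply/eqP; rewrite eq_le (le_trans (fp t) (sp t))/=.
rewrite -lerN2 (le_trans _ sN)// (le_trans _ (fp _))//.
by have := sublinear_ge (- t) fs; rewrite opprK.
Qed.

End Sublinear.

(** * Scalars and the underlying real normed space *)

Section ScalarFacts.
Context {R : realType} {c : scalar_kind}.
Local Notation K := (scalars R c).
Implicit Types (x y z : K) (r s : R).

Lemma scalar_ofD r s : scalar_of c (r + s) = scalar_of c r + scalar_of c s.
Proof. by case: c => //=; exact: rmorphD. Qed.

Lemma scalar_ofM r s : scalar_of c (r * s) = scalar_of c r * scalar_of c s.
Proof. by case: c => //=; exact: rmorphM. Qed.

Lemma scalar_of0 : scalar_of c (0 : R) = 0.
Proof. by case: c. Qed.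

Lemma scalar_of1 : scalar_of c (1 : R) = 1.
Proof. by case: c. Qed.

Lemma scalar_reD x y : scalar_re (x + y) = scalar_re x + scalar_re y.
Proof. by move: x y; case: c => //= -[a b] [a' b']. Qed.

Lemma scalar_re_of r x : scalar_re (scalar_of c r * x) = r * scalar_re x.
Proof. by move: x; case: c => //= -[a b] /=; rewrite mul0r subr0. Qed.

Lemma scalar_re0 : scalar_re (0 : K) = 0.
Proof. by case: c. Qed.

Lemma scalar_re1 : scalar_re (1 : K) = 1.
Proof. by case: c. Qed.

Lemma scalar_re_ge0 x : 0 <= x -> 0 <= scalar_re x.
Proof. by move=> /ler_scalar_re; rewrite scalar_re0. Qed.

Lemma scalar_of_ge0 r : (0 <= scalar_of c r) = (0 <= r).
Proof. by rewrite -scalar_of0 ler_scalar_of. Qed.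

Lemma ltr_scalar_of r s : (scalar_of c r < scalar_of c s) = (r < s).
Proof. by rewrite !lt_neqAle ler_scalar_of (can_eq scalar_ofK). Qed.

Lemma scalar_of_gt0 r : (0 < scalar_of c r) = (0 < r).
Proof. by rewrite -scalar_of0 ltr_scalar_of. Qed.

Lemma scalar_reM x y : 0 <= x -> scalar_re (x * y) = scalar_re x * scalar_re y.
Proof. by move=> /scalar_reK <-; rewrite scalar_re_of scalar_ofK. Qed.

Lemma norm_scalar_of r : `|scalar_of c r| = scalar_of c `|r|.
Proof. by case: c => //=; rewrite normc_def /= expr0n addr0 sqrtr_sqr. Qed.

Lemma scalar_re_le_norm x : scalar_re x <= scalar_re `|x|.
Proof.
move: x; case: c => [x|[a b]]; first exact: ler_norm.
rewrite normc_def /= (le_trans (ler_norm a))// -sqrtr_sqr ler_wsqrtr//.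
by rewrite lerDl sqr_ge0.
Qed.

Lemma exists_phase x : exists2 w : K, `|w| = 1 & w * x = `|x|.
Proof.
have [->|x0] := eqVneq x 0; first by exists 1; rewrite ?normr1// mulr0 normr0.
move: x x0; case: c => [x x0|x x0].
  exists (Num.sg x); first by rewrite normr_sg x0.
  by rewrite -normrEsg.
exists (`|x| / x).
  by rewrite normrM normr_id normfV divff// normr_eq0.
by rewrite mulrAC -mulrA divff// mulr1.
Qed.

End ScalarFacts.

(** Restriction of scalars to the reals; an alias, so that the real structure
    does not compete with the one over the scalars. *)
Definition realify (R : realType) (c : scalar_kind)
  (X : normedModType (scalars R c)) : Type := X.

Section Realify.
Context {R : realType} {c : scalar_kind} (X : normedModType (scalars R c)).
Local Notation Xr := (realify X).

HB.instance Definition _ := GRing.Zmodule.copy Xr X.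

Let rscale (r : R) (x : Xr) : Xr := scalar_of c r *: (x : X).

Let rscaleA a b x : rscale a (rscale b x) = rscale (a * b) x.
Proof. by rewrite /rscale scalar_ofM scalerA. Qed.
Let rscale1 : left_id 1 rscale.
Proof. by move=> x; rewrite /rscale scalar_of1 scale1r. Qed.
Let rscaleDr : right_distributive rscale +%R.
Proof. by move=> a x y; rewrite /rscale -scalerDr. Qed.
Let rscaleDl x : {morph rscale^~ x : a b / a + b}.
Proof. by move=> a b; rewrite /rscale scalar_ofD scalerDl. Qed.

HB.instance Definition _ :=
  GRing.Zmodule_isLmodule.Build R Xr rscaleA rscale1 rscaleDr rscaleDl.

Let rnorm (x : Xr) : R := scalar_re `|x : X|.

Let rnormD x y : rnorm (x + y) <= rnorm x + rnorm y.
Proof. by rewrite /rnorm -scalar_reD ler_scalar_re// ler_normD. Qed.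
Let rnormZ (r : R) (x : Xr) : rnorm (r *: x) = `|r| * rnorm x.
Proof. by rewrite /rnorm normrZ norm_scalar_of scalar_re_of. Qed.
Let rnorm0_eq0 (x : Xr) : rnorm x = 0 -> x = 0.
Proof.
move=> x0; apply/eqP; rewrite -[_ == _]normr_eq0 -[X in X == _]scalar_reK//.
by rewrite -/(rnorm x) x0 scalar_of0.
Qed.

HB.instance Definition _ :=
  Lmodule_isNormed.Build R Xr rnormD rnormZ rnorm0_eq0.

End Realify.

Section RealifyTheory.
Context {R : realType} {c : scalar_kind} {X Y : normedModType (scalars R c)}.
Local Notation Xr := (realify X).

Lemma realify_normE (x : X) : `|x : Xr| = scalar_re `|x|.
Proof. by []. Qed.

Lemma realify_norm_le (x : X) (y : Y) (r : R) :
  (`|x : Xr| <= r * `|y : realify Y|) = (`|x| <= scalar_of c r * `|y|).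
Proof.
rewrite -[X in _ = (X <= _)]scalar_reK// -[X in _ = (_ <= _ * X)]scalar_reK//.
by rewrite -scalar_ofM ler_scalar_of.
Qed.

Lemma realify_normZ (z : scalars R c) (x : X) :
  `|z *: x : Xr| = scalar_re `|z| * `|x : Xr|.
Proof. by rewrite !realify_normE normrZ scalar_reM. Qed.

End RealifyTheory.

(** * From functionals to approximate solutions *)

Section RealFunctionals.
Context {R : realType}.

(** The real parts of scalar-linear functionals are exactly the real-linear
    functionals: in the complex case [f] is the real part of
    [x |-> f x - i f (i x)]. *)
Lemma linear_of_real_part (c : scalar_kind) (X : normedModType (scalars R c))
    (f : realify X -> R^o) : linear f ->
  exists2 F : X -> (scalars R c)^o, linear F & forall x, scalar_re (F x) = f x.
Proof.
case: c X f => [X f fl|X f fl]; first by exists f.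
have fD (x y : X) : f (x + y : X) = f x + f y.
  by have := fl 1 x y; rewrite !scale1r.
have fZ r (x : X) : f (scalar_of ComplexScalars r *: x : X) = r * f x.
  have f0 : f (0 : X) = 0 by have := fD 0 0; rewrite addr0; lra.
  by have := fl r x (0 : X); rewrite f0 !addr0.
pose F (x : X) : R[i]^o := (f x +i* - f ('i%C *: x : X))%C.
exists F => // z x y.
have FD : F (x + y) = F x + F y.
  by rewrite /F scalerDr !fD; apply/eqP; rewrite eq_complex /= opprD !eqxx.
have FDz : F (z *: x + y) = F (z *: x) + F y.
  by rewrite /F scalerDr !fD; apply/eqP; rewrite eq_complex /= opprD !eqxx.
rewrite FDz; congr (_ + _) => {y FD FDz}.
case: z => a b; set z := (a +i* b)%C.
have E1 : z *: x = scalar_of ComplexScalars a *: x +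
    scalar_of ComplexScalars b *: ('i%C *: x).
  rewrite scalerA -scalerDl; congr (_ *: _).
  by apply/eqP; rewrite eq_complex /=; apply/andP; split; apply/eqP; ring.
have E2 : 'i%C *: (z *: x) = scalar_of ComplexScalars a *: ('i%C *: x) +
    scalar_of ComplexScalars (- b) *: x.
  rewrite !scalerA -scalerDl; congr (_ *: _).
  by apply/eqP; rewrite eq_complex /=; apply/andP; split; apply/eqP; ring.
rewrite /F E2 E1 !fD !fZ.
by apply/eqP; rewrite eq_complex /=; apply/andP; split; apply/eqP; ring.
Qed.

Context {c : scalar_kind}.
Local Notation K := (scalars R c).
Implicit Types (A E X : normedModType K).

(** Multiplying the argument by a phase turns the modulus of a scalar
    functional into its real part. *)
Lemma norm_le_of_real_part X (F : X -> K^o) (C : R) : linear F ->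
  (forall x, scalar_re (F x) <= C * `|x : realify X|) ->
  forall x, `|F x : realify K^o| <= C * `|x : realify X|.
Proof.
move=> Fl FC x; have [w w1 wx] := exists_phase (F x).
have FZ : F (w *: x) = w * F x.
  have F0 : F 0 = 0 by have := Fl (-1) 0 0; rewrite scaler0 addr0 scaleN1r addNr.
  by have := Fl w x 0; rewrite F0 !addr0.
have := FC (w *: x); rewrite FZ wx => /le_trans; apply.
by rewrite realify_normZ w1 scalar_re1 mul1r.
Qed.

Lemma dual_of_bound X (F : X -> K^o) (C : R) : 0 <= C -> linear F ->
  (forall x, `|F x : realify K^o| <= C * `|x : realify X|) ->
  exists G : dual X, forall x, G x = F x.
Proof.
move=> C0 Fl FC; have H : F \in is_dual X.
  apply: (@is_dual_bounded _ _ _ _ (scalar_of c C)) => //.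
    by rewrite scalar_of_ge0.
  by move=> x; have := FC x; rewrite realify_norm_le.
by exists (Dual H).
Qed.

Lemma realify_dual_norm X (F : dual X) x :
  `|F x : realify K^o| <= `|F : realify (dual X)| * `|x : realify X|.
Proof. by rewrite realify_norm_le realify_normE scalar_reK// ler_dual_norm. Qed.

Lemma realify_dual_norm_le X (F : dual X) (C : R) : 0 <= C ->
  (forall x, `|F x : realify K^o| <= C * `|x : realify X|) ->
  `|F : realify (dual X)| <= C.
Proof.
move=> C0 FC; rewrite realify_normE -(@ler_scalar_of _ c) scalar_reK//.
apply: dual_norm_ler; first by rewrite scalar_of_ge0.
by move=> x; have := FC x; rewrite realify_norm_le.
Qed.

(** Let [p v] be the infimum over [a] of [`|a| + d * `|v - L a|], where
    [d = (M + 1) / e]. A functional dominated by this seminorm is bounded by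
    [`|a|] at [L a], so [p t <= M] by Hahn-Banach and the hypothesis; any [a]
    giving a value below [M + 1] at [t] is as required. *)
Lemma helly A E (L : A -> E) (t : E) (M : R) : linear L -> 0 <= M ->
    (forall (F : dual E) C, 0 <= C ->
      (forall a, `|F (L a) : realify K^o| <= C * `|a : realify A|) ->
      `|F t : realify K^o| <= C * M) ->
  forall e, 0 < e -> exists a, `|a : realify A| <= M + 1 /\
    `|t - L a : realify E| <= e.
Proof.
move=> Ll M0 tM e e0.
have d0 : 0 < (M + 1) / e by rewrite divr_gt0//; lra.
set d := (M + 1) / e in d0.
have LD a b : L (a + b) = L a + L b by have := Ll 1 a b; rewrite !scale1r.
have LZ r a : L (r *: a) = r *: L a.
  have L0 : L 0 = 0 by have := Ll (-1) 0 0; rewrite scaler0 addr0 scaleN1r addNr.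
  by have := Ll r a 0; rewrite L0 !addr0.
pose g (a : realify A) (v : realify E) : R := `|a| + d * `|v - (L a : realify E)|.
pose p v := inf [set f v | f in [set g a | a in [set: realify A]]].
have g0 a v : 0 <= g a v by rewrite addr_ge0// mulr_ge0// ltW.
have p_le a v : p v <= g a v.
  apply: ge_inf; last by exists (g a) => //; exists a.
  by exists 0 => _ [_ [b _ <-] <-].
have ps : sublinear p.
  apply: (sublinear_inf (b := fun=> 0)).
  - by exists (g 0), 0.
  - by move=> _ v [a _ <-].
  - move=> _ _ x y [a _ <-] [b _ <-]; exists (g (a + b)); first by exists (a + b).
    rewrite /g; have -> : x + y - (L (a + b) : realify E) =
        (x - (L a : realify E)) + (y - (L b : realify E)).
      by rewrite [L _]LD opprD addrACA.
    have := ler_normD a b.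
    have := ler_normD (x - (L a : realify E)) (y - (L b : realify E)).
    by move=> /(ler_wpM2l (ltW d0)); lra.
  - move=> r _ x r0 [a _ <-]; exists (g (r *: a)); first by exists (r *: a).
    rewrite /g; have -> : r *: x - (L (r *: a) : realify E) =
        r *: (x - (L a : realify E)).
      by rewrite [L _]LZ scalerBr.
    by rewrite !normrZ (gtr0_norm r0) mulrDr mulrCA.
have [f [fl fp ft]] := hahn_banach (t : realify E) ps.
have [G Gl Gf] := linear_of_real_part fl.
have GB v : `|G v : realify K^o| <= d * `|v : realify E|.
  apply: norm_le_of_real_part => // x; rewrite Gf (le_trans (fp x))//.
  apply: (le_trans (p_le 0 x)); rewrite /g normr0 add0r.
  have -> : L (0 : realify A) = (0 : realify E).
    by have := LZ 0 0; rewrite !scale0r.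
  by rewrite subr0.
have [F FG] := dual_of_bound (ltW d0) Gl GB.
have FL a : `|F (L a) : realify K^o| <= 1 * `|a : realify A|.
  rewrite FG; apply: (norm_le_of_real_part (F := G \o L)) => [z x y|b] /=.
    by rewrite Ll Gl.
  rewrite Gf (le_trans (fp _))// (le_trans (p_le b _))// /g.
  by rewrite subrr normr0 mulr0 addr0 mul1r.
have pt : p t < M + 1.
  rewrite -ft -Gf -FG (le_lt_trans (scalar_re_le_norm _))//.
  by have := tM F 1 ler01 FL; rewrite mul1r realify_normE; lra.
have [|_ [_ [a _ <-] <-] ga] := inf_lt _ pt.
  by exists (g 0 t), (g 0) => //; exists 0.
exists a; have := normr_ge0 a; have := normr_ge0 (t - (L a : realify E)).
move: ga; rewrite /g => ga n1 n2.
have n3 : 0 <= d * `|(t : realify E) - L a| by rewrite mulr_ge0// ltW.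
split; first by lra.
have : d * `|(t : realify E) - L a| <= d * e.
  by rewrite {2}/d divfK ?gt_eqF//; lra.
by rewrite ler_pM2l.
Qed.

End RealFunctionals.

(** * Completeness of dual spaces *)

Section GeometricCompleteness.
Context {R : realType}.
Implicit Types (V : normedModType R) (D q : R).

Lemma geometric_lt D q e : 0 <= q < 1 -> 0 < e -> exists n, D * q ^+ n < e.
Proof.
move=> /andP[q0 q1] e0.
have /cvgrPdist_lt /(_ e e0) [n _ /(_ n (leqnn n))] :
    (geometric D q) @ \oo --> (0 : R).
  by apply: cvg_geometric; rewrite ger0_norm.
rewrite sub0r normrN /geometric /= => nD; exists n.
exact: le_lt_trans (ler_norm _) nD.
Qed.

Lemma geometric_le0 (a : R) D q : 0 <= q < 1 ->
  (forall n, a <= D * q ^+ n) -> a <= 0.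
Proof.
move=> q01 aD; rewrite leNgt; apply/negP => a0.
by have [n] := geometric_lt D q01 a0; rewrite ltNge aD.
Qed.

(** Completeness, as the convergence of sequences with geometrically decreasing
    steps, together with the resulting rate of convergence. *)
Definition geometrically_complete V :=
  forall (u : nat -> V) D q, 0 <= q < 1 ->
    (forall n, `|u n.+1 - u n| <= D * q ^+ n) ->
  exists l, forall n, `|l - u n| <= D / (1 - q) * q ^+ n.

Lemma geometric_tail V (u : nat -> V) D q : 0 <= q < 1 ->
  (forall n, `|u n.+1 - u n| <= D * q ^+ n) ->
  forall n m, (n <= m)%N -> `|u m - u n| <= D / (1 - q) * q ^+ n.
Proof.
move=> /andP[q0 q1] uD n m nm.
have D0 : 0 <= D by have := uD 0%N; rewrite expr0 mulr1; exact: le_trans.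
have q'0 : 0 < 1 - q by lra.
suff H k : `|u (n + k)%N - u n| <= D / (1 - q) * (q ^+ n - q ^+ (n + k)).
  rewrite -(subnKC nm) (le_trans (H _))// ler_wpM2l ?divr_ge0 ?(ltW q'0)//.
  by rewrite lerBlDr lerDl exprn_ge0.
elim: k => [|k IH]; first by rewrite addn0 !subrr normr0 mulr0.
rewrite addnS.
have := ler_normD (u (n + k).+1 - u (n + k)%N) (u (n + k)%N - u n).
rewrite addrA subrK => /le_trans; apply.
rewrite (le_trans (lerD (uD _) IH))// exprS.
have DE : D = D / (1 - q) * (1 - q) by rewrite divfK// gt_eqF.
by rewrite {1}DE; lra.
Qed.

Lemma complete_realify (c : scalar_kind)
    (X : completeNormedModType (scalars R c)) :
  geometrically_complete (realify X).
Proof.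
move=> u D q q01 uD.
have tail := geometric_tail q01 uD.
have cu : cauchy ((u : nat -> X) @ \oo).
  apply/cauchyP => e e0.
  have eE := scalar_reK (ltW e0).
  have re0 : 0 < scalar_re e by rewrite -(@scalar_of_gt0 _ c) eE.
  have [n nD] := geometric_lt (D / (1 - q)) q01 re0.
  exists (u n); exists n => // m /= nm; rewrite -ball_normE /=.
  rewrite distrC -eE -[ltLHS]scalar_reK// ltr_scalar_of.
  exact: le_lt_trans (tail _ _ nm) nD.
have /cvg_ex[l ul] : cvg ((u : nat -> X) @ \oo) by exact: cauchy_cvg.
exists l => n; apply/ler_addgt0Pr => e e0.
have e0' : 0 < scalar_of c e. by rewrite scalar_of_gt0.
have /cvgrPdist_le/(_ _ e0')[N _ NP] := ul.
have := NP (maxn N n) (leq_maxl _ _); rewrite /= => lu.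
have {}lu : `|(l : realify X) - u (maxn N n)| <= e.
  by have := ler_scalar_re lu; rewrite scalar_ofK.
have := tail n (maxn N n) (leq_maxr _ _).
have := ler_normD ((l : realify X) - u (maxn N n)) (u (maxn N n) - u n).
by rewrite addrA subrK; lra.
Qed.

(** Let [m] grow in [`|l - u n| <= `|l - u (n + m)| + `|u (n + m) - u n|]. *)
Lemma geometric_rate V (u : nat -> V) D q (l : V) K : 0 <= q < 1 ->
    (forall n, `|u n.+1 - u n| <= D * q ^+ n) ->
    (forall n, `|l - u n| <= K * q ^+ n) ->
  forall n, `|l - u n| <= D / (1 - q) * q ^+ n.
Proof.
move=> q01 uD lK n; rewrite -subr_le0.
have tail := geometric_tail q01 uD.
apply: (geometric_le0 (D := K) q01) => m; have /andP[q0 q1] := q01.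
have := ler_normD (l - u (n + m)%N) (u (n + m)%N - u n).
rewrite addrA subrK.
have := tail n (n + m)%N (leq_addr _ _); have := lK (n + m)%N.
have K0 : 0 <= K by have := lK 0%N; rewrite expr0 mulr1; exact: le_trans.
have : K * q ^+ (n + m) <= K * q ^+ m.
  by rewrite ler_wpM2l// exprD ler_piMl ?exprn_ge0// exprn_ile1// ltW.
lra.
Qed.

Lemma complete_scalars (c : scalar_kind) :
  geometrically_complete (realify (scalars R c)^o).
Proof.
have RC : geometrically_complete
    (realify (R^o : normedModType (scalars R RealScalars))).
  exact: (@complete_realify RealScalars R^o).
case: c => // u D q q01 uD.
have normE (z : R[i]^o) :
    `|z : realify (R[i]^o : normedModType (scalars R ComplexScalars))| =
    Num.sqrt (complex.Re z ^+ 2 + complex.Im z ^+ 2) by case: z.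
have rele (a b : R) : `|a| <= Num.sqrt (a ^+ 2 + b ^+ 2).
  by rewrite -sqrtr_sqr ler_wsqrtr// lerDl sqr_ge0.
have imle (a b : R) : `|b| <= Num.sqrt (a ^+ 2 + b ^+ 2).
  by rewrite -sqrtr_sqr ler_wsqrtr// lerDr sqr_ge0.
have leD (a b : R) : Num.sqrt (a ^+ 2 + b ^+ 2) <= `|a| + `|b|.
  rewrite -[leRHS]ger0_norm ?addr_ge0// -sqrtr_sqr ler_wsqrtr//.
  rewrite sqrrD !real_normK ?num_real// lerD2r lerDl.
  by rewrite mulrn_wge0// mulr_ge0.
have [n|a aE] := RC (fun n => complex.Re (u n)) D q q01.
  apply: le_trans (uD n); rewrite normE.
  by case: (u n) (u n.+1) => [? ?] [? ?]; exact: rele.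
have [n|b bE] := RC (fun n => complex.Im (u n)) D q q01.
  apply: le_trans (uD n); rewrite normE.
  by case: (u n) (u n.+1) => [? ?] [? ?]; exact: imle.
exists (a +i* b)%C.
apply: (geometric_rate (K := D / (1 - q) + D / (1 - q)) q01 uD) => n.
rewrite normE mulrDl; apply: le_trans (lerD (aE n) (bE n)).
by case: (u n) => ? ?; exact: leD.
Qed.

(** Pointwise limits: the rate at [x] is uniform for [x] in the unit ball, so
    convergence holds in norm. *)
Lemma complete_dual (c : scalar_kind) (X : normedModType (scalars R c)) :
  geometrically_complete (realify (dual X)).
Proof.
move=> u D q q01 uD; have /andP[q0 q1] := q01.
have D0 : 0 <= D by have := uD 0%N; rewrite expr0 mulr1; exact: le_trans.
have q'0 : 0 < 1 - q by lra.
have lx (x : X) : exists l : realify (scalars R c)^o, forall n,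
    `|l - u n x| <= D / (1 - q) * q ^+ n * `|x : realify X|.
  have [n|l lE] :=
      @complete_scalars c (fun n => u n x) (D * `|x : realify X|) q q01.
    rewrite mulrAC; apply: le_trans (ler_wpM2r (normr_ge0 _) (uD n)).
    exact: (realify_dual_norm (u n.+1 - u n : dual X) x).
  by exists l => n; apply: le_trans (lE n) _; rewrite [leLHS]mulrAC -!mulrA; lra.
have [l lE] := choice lx.
have ll : linear (l : X -> (scalars R c)^o).
  move=> z x y; apply/eqP; rewrite -subr_eq0.
  rewrite -[_ == 0](@normr_eq0 _ (realify (scalars R c)^o)).
  rewrite eq_le normr_ge0 andbT.
  pose zn := `|z : realify (scalars R c)^o|.
  pose K := D / (1 - q) * (`|z *: x + y : realify X| + zn * `|x : realify X| +
    `|y : realify X|).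
  apply: (geometric_le0 (D := K) q01) => n.
  have -> : (l (z *: x + y) - (z *: l x + l y) : (scalars R c)^o) =
      (l (z *: x + y) - u n (z *: x + y)) - z *: (l x - u n x) - (l y - u n y).
    by rewrite [u n _]linearP scalerBr !opprD !opprK; ring.
  pose p1 : realify (scalars R c)^o := l (z *: x + y) - u n (z *: x + y).
  pose p2 : realify (scalars R c)^o := l x - u n x.
  pose p3 : realify (scalars R c)^o := l y - u n y.
  rewrite (le_trans (ler_normB (p1 - (z *: (p2 : (scalars R c)^o))) p3))//.
  have := ler_normB p1 (z *: (p2 : (scalars R c)^o)).
  rewrite [X in _ <= _ + X](@realify_normZ _ _ (scalars R c)^o) -[scalar_re _]/zn.
  have := lE (z *: x + y) n; have := lE y n; have := lE x n.
  rewrite -/p1 -/p2 -/p3 => e2 e3 e1.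
  have : zn * `|p2| <= zn * (D / (1 - q) * q ^+ n * `|x : realify X|).
    by apply: ler_wpM2l e2; exact: normr_ge0.
  rewrite /K; lra.
have B0 : 0 <= D / (1 - q) + `|u 0%N| by rewrite addr_ge0// divr_ge0// ltW.
have [|g gl] := dual_of_bound B0 ll.
  move=> x.
  have := ler_normD (l x - u 0%N x) (u 0%N x : realify (scalars R c)^o).
  rewrite subrK mulrDl => /le_trans; apply; apply: lerD.
    by have := lE x 0%N; rewrite expr0 mulr1.
  exact: realify_dual_norm.
exists g => n; apply: realify_dual_norm_le => [|x].
  by rewrite mulr_ge0 ?exprn_ge0// divr_ge0// ltW.
by have := lE x n; rewrite -gl.
Qed.

End GeometricCompleteness.

(** * Operators with bounded solutions *)

Section Solvability.
Context {R : realType} {X : normedModType R}.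
Implicit Types (T S U : X -> X) (K : R).

(** Surjectivity with the constant of the open mapping theorem. It passes to
    compositions and to small perturbations by choosing solutions, without
    forming inverse operators. *)
Definition solvable T K :=
  forall z, exists2 w, T w = z & `|w| <= K * `|z|.

Lemma solvable_comp T U K L : 0 <= L ->
  solvable T K -> solvable U L -> solvable (T \o U) (L * K).
Proof.
move=> L0 TK UL z; have [v Tv vz] := TK z; have [w Uw wv] := UL v.
exists w; first by rewrite /= Uw.
by rewrite (le_trans wv)// -mulrA ler_wpM2l.
Qed.

Lemma solvable_ext T U K : T =1 U -> solvable T K -> solvable U K.
Proof. by move=> TU TK z; have [w <- wz] := TK z; exists w. Qed.

(** Neumann series: iterate the correction [w |-> T^-1 (- S w)]. *)
Lemma solvable_perturb T S K d B : geometrically_complete X ->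
    linear T -> linear S -> 0 <= K -> 0 <= B -> 0 <= d ->
    (forall x, `|T x| <= B * `|x|) -> (forall x, `|S x| <= d * `|x|) ->
    K * d <= 2^-1 -> solvable T K ->
  solvable (fun x => T x + S x) (2 * K).
Proof.
move=> Xc Tl Sl K0 B0 d0 TB Sd Kd TK z.
have {}TK z' : exists w, T w = z' /\ `|w| <= K * `|z'|.
  by have [w] := TK z'; exists w.
have [sol solP] := choice TK.
pose w n := iter n (fun v => sol (- S v)) (sol z).
have wn n : `|w n| <= K * `|z| * 2^-1 ^+ n.
  elim: n => [|n IH]; first by rewrite expr0 mulr1; exact: (solP z).2.
  rewrite /w iterS -/(w n) (le_trans (solP _).2)// normrN.
  apply: le_trans (ler_wpM2l K0 (Sd _)) _.
  rewrite mulrA (le_trans (ler_wpM2r (normr_ge0 _) Kd))//.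
  by rewrite exprS mulrCA ler_wpM2l// invr_ge0.
pose u n := \sum_(i < n) w i.
have q01 : 0 <= (2^-1 : R) < 1 by apply/andP; split; lra.
have [n|l lu] := Xc u (K * `|z|) 2^-1 q01.
  by rewrite /u big_ord_recr/= addrAC subrr add0r.
have E : K * `|z| / (1 - 2^-1) = 2 * K * `|z| by field.
rewrite {}E in lu.
have TD x y : T (x + y) = T x + T y by have := Tl 1 x y; rewrite !scale1r.
have SD x y : S (x + y) = S x + S y by have := Sl 1 x y; rewrite !scale1r.
have T0 : T 0 = 0 by have := TD 0 0; rewrite addr0 -{1}[T 0]addr0 => /addrI.
have S0 : S 0 = 0 by have := SD 0 0; rewrite addr0 -{1}[S 0]addr0 => /addrI.
have TSu n : T (u n.+1) + S (u n.+1) = z + S (w n).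
  elim: n => [|n IH].
    by rewrite /u big_ord_recr big_ord0/= add0r (solP z).1.
  have -> : u n.+2 = u n.+1 + w n.+1 by rewrite /u big_ord_recr.
  rewrite TD SD addrACA IH -!addrA; congr (_ + _).
  by rewrite [T _](solP _).1 addrA subrr add0r.
exists l; last first.
  by have := lu 0%N; rewrite /u big_ord0 subr0 expr0 mulr1.
apply/eqP; rewrite -subr_eq0 -normr_eq0 eq_le normr_ge0 andbT.
pose D := (B + d) * (2 * K * `|z|) + d * (K * `|z|).
apply: (geometric_le0 (D := D) q01) => n.
have -> : T l + S l - z = (T (l - u n.+1) + S (l - u n.+1)) + S (w n).
  rewrite -{1 2}(subrK (u n.+1) l) TD SD addrACA TSu.
  by rewrite [z + _]addrC addrA addrK.
rewrite (le_trans (ler_normD _ _))//.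
have := ler_normD (T (l - u n.+1)) (S (l - u n.+1)).
have := TB (l - u n.+1); have := Sd (l - u n.+1); have := Sd (w n).
have := ler_wpM2l d0 (wn n).
have := ler_wpM2l (addr_ge0 B0 d0) (lu n.+1); rewrite exprS /D => l1 l2 l3 l4 l5.
have : 0 <= (B + d) * (2 * K * `|z|) * 2^-1 ^+ n.
  by rewrite !mulr_ge0 ?addr_ge0// exprn_ge0// invr_ge0.
lra.
Qed.

End Solvability.

(** * Cohen factorization *)

Section Factorization.
Context {R : realType} {A X : normedModType R}.
Variables (mul : A -> A -> A) (act : A -> X -> X) (C M : R).
Hypotheses (A_complete : geometrically_complete A)
  (X_complete : geometrically_complete X).
Hypotheses (act_bilinear : bilinear_for *:%R *:%R act) (C0 : 0 <= C)
  (act_bound : forall a x, `|act a x| <= C * `|a| * `|x|)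
  (actM : forall a b x, act (mul a b) x = act a (act b x)).
Hypotheses (M0 : 0 <= M)
  (approx_unit : forall s y e, 0 < e -> exists a,
    [/\ `|a| <= M, `|y - act a y| <= e & `|s - mul s a| <= e]).

Let actDl a b x : act (a + b) x = act a x + act b x.
Proof. by have := act_bilinear.1 x 1 a b; rewrite /= !scale1r. Qed.

Let actDr a x y : act a (x + y) = act a x + act a y.
Proof. by have := act_bilinear.2 a 1 x y; rewrite /= !scale1r. Qed.

Let act0l x : act 0 x = 0.
Proof. by have := actDl 0 0 x; rewrite addr0 -{1}[act 0 x]addr0 => /addrI. Qed.

Let act0r a : act a 0 = 0.
Proof. by have := actDr a 0 0; rewrite addr0 -{1}[act a 0]addr0 => /addrI. Qed.

Let actZl r a x : act (r *: a) x = r *: act a x.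
Proof. by have := act_bilinear.1 x r a 0; rewrite /= act0l !addr0. Qed.

Let actZr r a x : act a (r *: x) = r *: act a x.
Proof. by have := act_bilinear.2 a r x 0; rewrite /= act0r !addr0. Qed.

Let actBl a b x : act (a - b) x = act a x - act b x.
Proof. by rewrite actDl -[- b]scaleN1r actZl scaleN1r. Qed.

Let actBr a x y : act a (x - y) = act a x - act a y.
Proof. by rewrite actDr -[- y]scaleN1r actZr scaleN1r. Qed.

Variable c : R.
Hypotheses (c_gt0 : 0 < c) (cE : c * (1 + C * M) = 2^-1).
Let q : R := 1 - c.

Let CM0 : 0 <= C * M. Proof. exact: mulr_ge0. Qed.

Let c_le : c <= 2^-1.
Proof. by rewrite -cE; have := mulr_ge0 (ltW c_gt0) CM0; lra. Qed.

Let q01 : 0 <= q < 1.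
Proof. by have := c_gt0; have := c_le; rewrite /q; lra. Qed.

(** The operators [s + r 1] of Cohen's construction. *)
Let shifted s r (x : X) := act s x + r *: x.

Let shifted_linear s r : linear (shifted s r).
Proof.
move=> k x y; rewrite /shifted actDr actZr !scalerDr !scalerA [r * k]mulrC.
by rewrite addrACA.
Qed.

Let shifted_bound s r x : `|shifted s r x| <= (C * `|s| + `|r|) * `|x|.
Proof.
rewrite (le_trans (ler_normD _ _))// mulrDl normrZ lerD2r.
exact: act_bound.
Qed.

(** With [U x = x - c (x - a x)], which is within [1/2] of the identity, and
    [s' = s + c r a],
      [shifted s' (q r) = shifted s r \o U + c (s - s a)].
    As [a] is almost a right unit for [s], the last term is negligible, and the
    bound on solutions for [s'] depends only on the one for [s]: it is known
    before [a] is chosen, so that [a] may also be taken to almost fix [y]. *)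
Let cohen_step s y r K : 0 <= r -> 0 <= K -> solvable (shifted s r) K ->
  exists s' y', [/\ `|s' - s| <= c * M * r, `|y' - y| <= r,
    shifted s' (q * r) y' = shifted s r y
    & solvable (shifted s' (q * r)) (2 * (2 * K))].
Proof.
move=> r0 K0 sK; have c0 := c_gt0. have c0' := ltW c0.
have P0 : 0 <= 4 * K * c by rewrite !mulr_ge0 ?ler0n.
have D0 : 0 < 1 + 4 * K * c * (C + 1) by rewrite ltr_wpDr// mulr_ge0// addr_ge0.
(* Small enough for [2 K * (c C e) <= 1/2], so that the perturbation applies,
   and for [4 K * (c r e) <= r], which bounds the change of [y]. *)
pose e := (1 + 4 * K * c * (C + 1))^-1.
have e0 : 0 < e by rewrite invr_gt0.
have eE : e * (1 + 4 * K * c * (C + 1)) = 1 by rewrite mulVf// gt_eqF.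
have Pe0 : 0 <= 4 * K * c * e by rewrite mulr_ge0 ?(ltW e0).
have PCe0 : 0 <= 4 * K * c * C * e.
  by rewrite !mulr_ge0 ?ler0n ?(ltW e0).
have e1 : 4 * K * c * C * e <= 1 by lra.
have e2 : 4 * K * c * e <= 1 by lra.
have [a [aM ya sa]] := approx_unit s y e0.
pose N x : X := - c *: (x - act a x).
pose U x := x + N x.
have Nl : linear N.
  move=> k x y'; rewrite /N actDr actZr opprD addrACA -scalerBr scalerDr.
  by rewrite !scalerA mulrC.
have NB x : `|N x| <= 2^-1 * `|x|.
  rewrite normrZ normrN gtr0_norm// -cE -mulrA ler_pM2l//.
  rewrite (le_trans (ler_normB _ _))// mulrDl mul1r lerD2l.
  rewrite (le_trans (act_bound a x))// ler_wpM2r// ler_wpM2l//.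
have U2 : solvable U (2 * 1).
  apply: (@solvable_perturb _ _ id N 1 2^-1 1) => //.
  - by rewrite invr_ge0.
  - by move=> x; rewrite mul1r.
  - by rewrite mul1r.
  - by move=> z; exists z; rewrite ?mul1r.
pose S x := c *: act (s - mul s a) x.
have Sl : linear S.
  move=> k x y'; rewrite /S actDr actZr scalerDr !scalerA [c * k]mulrC.
  by rewrite -scalerA.
have SB x : `|S x| <= c * C * e * `|x|.
  rewrite normrZ gtr0_norm// -!mulrA ler_pM2l// (le_trans (act_bound _ _))//.
  by rewrite mulrA ler_wpM2r// ler_wpM2l.
pose s' := s + (c * r) *: a.
have s'E x : shifted s' (q * r) x = shifted s r (U x) + S x.
  have NS : act s (N x) + S x = 0.
    by rewrite /S /N actZr actBr actBl actM -scalerDl addNr scale0r.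
  have rU : r *: U x = (q * r) *: x + (c * r) *: act a x.
    rewrite /U /N scalerDr scalerA scalerBr addrA -scalerDl -scaleNr.
    by congr (_ *: _ + _ *: _); rewrite /q; ring.
  rewrite /shifted actDl actZl /U actDr rU [RHS]addrAC.
  rewrite -(addrA (act s x) (act s (N x))) NS.
  by rewrite addr0 addrAC addrA.
have s'K : solvable (shifted s' (q * r)) (2 * (2 * K)).
  apply: (solvable_ext (fun x => esym (s'E x))).
  have := @solvable_perturb _ _ (shifted s r \o U) S (2 * 1 * K) (c * C * e)
    ((C * `|s| + `|r|) * (1 + 2^-1)).
  rewrite mulr1; apply => //.
  - move=> k x y'; rewrite /= -shifted_linear; congr shifted.
    by rewrite /U Nl scalerDr addrACA.
  - by rewrite mulr_ge0.
  - by rewrite !(mulr_ge0, addr_ge0) ?invr_ge0.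
  - by rewrite !mulr_ge0 ?(ltW e0).
  - move=> x /=; rewrite (le_trans (shifted_bound _ _ _))// -mulrA.
    rewrite ler_wpM2l ?addr_ge0 ?mulr_ge0// (le_trans (ler_normD _ _))//.
    by rewrite mulrDl mul1r lerD2l.
  - by lra.
  - by have := solvable_comp _ sK U2; rewrite mulr1; apply.
have [d dE dB] := s'K (shifted s r y - shifted s' (q * r) y).
exists s', (y + d); split => //.
- rewrite /s' addrAC subrr add0r normrZ ger0_norm; last by rewrite mulr_ge0// ltW.
  by rewrite mulrAC ler_wpM2r// ler_wpM2l// ltW.
- rewrite addrAC subrr add0r (le_trans dB)//.
  have -> : shifted s r y - shifted s' (q * r) y = (c * r) *: (y - act a y).
    have -> : q * r = r - c * r by rewrite /q; ring.
    rewrite /shifted actDl actZl scalerBl scalerBr; apply/eqP.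
    rewrite subr_eq [act s y + (c * r) *: _]addrC -(addrA ((c * r) *: act a y)).
    by rewrite subrKA (addrA (act s y)) [(c * r) *: y + _]addrC subrK.
  rewrite normrZ ger0_norm; last by rewrite mulr_ge0// ltW.
  have := ler_wpM2r r0 e2.
  have : 0 <= 2 * (2 * K) * (c * r) by rewrite !mulr_ge0// ltW.
  by move=> /ler_wpM2l/(_ _ _ ya); lra.
- have := shifted_linear s' (q * r) 1 y d; rewrite !scale1r => ->.
  by rewrite dE addrC subrK.
Qed.

(** Iterating [cohen_step] from [s = 0], [y = x], [r = 1]: both sequences
    converge geometrically, and the remainder [q ^ n y_n] vanishes. *)
Lemma cohen_factorization_with_step x : exists a y, act a y = x.
Proof.
pose P n (p : A * X) := shifted p.1 (q ^+ n) p.2 = x /\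
  exists2 K, 0 <= K & solvable (shifted p.1 (q ^+ n)) K.
pose Q n (p p' : A * X) := `|p'.1 - p.1| <= c * M * q ^+ n /\
  `|p'.2 - p.2| <= 1 * q ^+ n.
have /andP[q0 q1] := q01.
have step (np : nat * (A * X)) :
    exists p', P np.1 np.2 -> P np.1.+1 p' /\ Q np.1 np.2 p'.
  case: np => n [s y] /=; have [[/= Ps [K K0 sK]]|nP] := pselect (P n (s, y)).
    have [s' [y' [ss yy E s'K]]] := cohen_step y (exprn_ge0 n q0) K0 sK.
    exists (s', y') => _; rewrite /P /Q/= exprS mul1r E; split=> //.
    by split=> //; exists (2 * (2 * K)) => //; rewrite !mulr_ge0.
  by exists (s, y).
have [f fP] := choice step.
pose st n := iteri n (fun i p => f (i, p)) (0, x).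
have stP n : P n (st n).
  elim: n => [|n IH]; last exact: (fP (n, st n) IH).1.
  rewrite /P /shifted /= expr0; split; first by rewrite act0l add0r scale1r.
  by exists 1 => // z; exists z; rewrite ?act0l ?add0r ?scale1r ?mul1r.
have stQ n : Q n (st n) (st n.+1) by exact: (fP (n, st n) (stP n)).2.
have [a aE] := A_complete q01 (fun n => (stQ n).1).
have [y yE] := X_complete q01 (fun n => (stQ n).2).
exists a, y; apply/eqP; rewrite -subr_eq0 -normr_eq0 eq_le normr_ge0 andbT.
pose Da := c * M / (1 - q); pose Dy := 1 / (1 - q).
have Da0 : 0 <= Da by rewrite /Da divr_ge0 ?subr_ge0 ?mulr_ge0// ltW.
have Dy0 : 0 <= Dy by rewrite /Dy divr_ge0 ?subr_ge0// ltW.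
pose D := C * Da * `|y| + (C * (`|a| + Da) + 1) * Dy + `|y|.
apply: (geometric_le0 (D := D) q01) => n.
have [xE _] := stP n; have := aE n; have := yE n.
rewrite -/Da -/Dy; set s := (st n).1 in xE *; set v := (st n).2 in xE *.
set r := q ^+ n in xE * => vy sa.
have -> : act a y - x = act (a - s) y + (act s (y - v) + r *: (y - v)) - r *: y.
  rewrite -xE /shifted actBl actBr scalerBr addrA (addrA (act a y - _)) subrK.
  by rewrite -[RHS]addrA [r *: y - _ - _]addrAC subrr add0r opprD addrA.
have r0 : 0 <= r by exact: exprn_ge0.
have r1 : r <= 1 by rewrite exprn_ile1// ltW.
have sB : `|s| <= `|a| + Da.
  have := ler_normB a (a - s); rewrite opprB addrC subrK => /le_trans; apply.
  by rewrite lerD2l (le_trans sa)// ler_piMr.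
have := ler_normB (act (a - s) y + (act s (y - v) + r *: (y - v))) (r *: y).
have := ler_normD (act (a - s) y) (act s (y - v) + r *: (y - v)).
have := ler_normD (act s (y - v)) (r *: (y - v)).
rewrite !normrZ ger0_norm//.
have := ler_wpM2r (normr_ge0 y) (ler_wpM2l C0 sa).
have := act_bound (a - s) y; have := act_bound s (y - v).
have := ler_pM (normr_ge0 s) (normr_ge0 (y - v)) sB vy.
move=> /(ler_wpM2l C0).
have := ler_wpM2r (normr_ge0 (y - v)) r1; have := normr_ge0 y.
rewrite /D; lra.
Qed.

End Factorization.

(** Cohen's factorization theorem for a left module over an algebra with a
    bounded right approximate unit that also acts as a left one on the module.
    The step [c] makes [U] in [cohen_step] a perturbation of the identity of
    size [1/2]. *)
Theorem cohen_factorization (R : realType) (A X : normedModType R)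
    (mul : A -> A -> A) (act : A -> X -> X) (C M : R) :
    geometrically_complete A -> geometrically_complete X ->
    bilinear_for *:%R *:%R act -> 0 <= C ->
    (forall a x, `|act a x| <= C * `|a| * `|x|) ->
    (forall a b x, act (mul a b) x = act a (act b x)) -> 0 <= M ->
    (forall s y e, 0 < e -> exists a,
      [/\ `|a| <= M, `|y - act a y| <= e & `|s - mul s a| <= e]) ->
  forall x, exists a y, act a y = x.
Proof.
move=> Ac Xc act2 C0 actB actM M0 au x.
have CM0 : 0 < 1 + C * M by rewrite ltr_wpDr// mulr_ge0.
apply: (cohen_factorization_with_step Ac Xc act2 C0 actB actM M0 au
  (c := 2^-1 / (1 + C * M))).
  by rewrite divr_gt0 ?invr_gt0.
by rewrite divfK// gt_eqF.
Qed.

(** * Units of the bidual and approximate units *)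

Section WeakUnits.
Context {R : realType} {c : scalar_kind}.
Local Notation K := (scalars R c).
Implicit Types (A X Y Z : normedModType K).

Lemma bbil_real_bound X Y Z (m : bbilinear X Y Z) : exists2 C : R, 0 <= C &
  forall x y, `|m x y : realify Z| <= C * `|x : realify X| * `|y : realify Y|.
Proof.
have [M M0 mM] := bbil_bounded m.
exists (scalar_re M); first exact: scalar_re_ge0.
move=> x y; have := ler_scalar_re (mM x y); rewrite scalar_reM ?mulr_ge0//.
by rewrite scalar_reM.
Qed.

Lemma bbil_real_bilinear X Y Z (m : bbilinear X Y Z) :
  bilinear_for *:%R *:%R (m : realify X -> realify Y -> realify Z).
Proof.
have [ml mr] := bbil_bilinear m.
by split=> x r u v; [exact: ml|exact: mr].
Qed.

Lemma norm_pair_comparable X Y (p : X * Y) : `|p.1| >=< `|p.2|.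
Proof. by apply: real_comparable; exact: normr_real. Qed.

Lemma realify_norm_fst X Y (p : X * Y) :
  `|p.1 : realify X| <= `|p : realify (X * Y)%type|.
Proof.
rewrite !realify_normE ler_scalar_re// prod_normE.
by rewrite comparable_le_max ?norm_pair_comparable// lexx.
Qed.

Lemma realify_norm_snd X Y (p : X * Y) :
  `|p.2 : realify Y| <= `|p : realify (X * Y)%type|.
Proof.
rewrite !realify_normE ler_scalar_re// prod_normE.
by rewrite comparable_le_max ?norm_pair_comparable// lexx orbT.
Qed.

Lemma is_dual_pair_l X Y (F : dual (X * Y)%type) :
  (fun x : X => F (x, 0)) \in is_dual X.
Proof.
apply: (@is_dual_bounded _ _ _ _ `|F|) => // [z x y|x].
  by rewrite -linearP; congr (F (_, _)); rewrite /= scaler0 addr0.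
rewrite (le_trans (ler_dual_norm _ _))// ler_wpM2l//.
rewrite prod_normE comparable_ge_max ?norm_pair_comparable//.
by rewrite /= normr0 lexx normr_ge0.
Qed.

Lemma is_dual_pair_r X Y (F : dual (X * Y)%type) :
  (fun y : Y => F (0, y)) \in is_dual Y.
Proof.
apply: (@is_dual_bounded _ _ _ _ `|F|) => // [z x y|x].
  by rewrite -linearP; congr (F (_, _)); rewrite /= scaler0 addr0.
rewrite (le_trans (ler_dual_norm _ _))// ler_wpM2l//.
rewrite prod_normE comparable_ge_max ?norm_pair_comparable//.
by rewrite /= normr0 lexx normr_ge0.
Qed.

(** [helly] applied to [a |-> (a y, s a)]: a functional on the product is a pair
    [F1, F2], and [e] sends [a |-> F1 (a y) + F2 (s a)] to [F1 y + F2 s]. Using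
    the product makes one [a] serve both purposes. *)
Lemma bounded_approximate_unit A X (m : bbilinear A A A) (act : bbilinear A X X)
    (e : dual (dual A)) :
    (forall F y, e (adjoint (transpose act) F y) = F y) ->
    (forall F s, e (adjoint m F s) = F s) ->
  forall s y d, 0 < d -> exists a, [/\ `|a : realify A| <=
      `|e : realify (dual (dual A))| + 1,
    `|y - act a y : realify X| <= d & `|s - m s a : realify A| <= d].
Proof.
move=> ey es s y d d0.
pose L a : (X * A)%type := (act a y, m s a).
have Ll : linear L.
  move=> z a b; have [al _] := bbil_bilinear act; have [_ mr] := bbil_bilinear m.
  by rewrite /L al mr.
have [] := @helly R c A (X * A)%type L (y, s)
  `|e : realify (dual (dual A))| Ll (normr_ge0 _) _ d d0.
  move=> F C C0 FL.
  pose F1 := Dual (is_dual_pair_l F); pose F2 := Dual (is_dual_pair_r F).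
  pose G := adjoint (transpose act) F1 y + adjoint m F2 s.
  have Fpair x a : F (x, a) = F (x, 0) + F (0, a).
    by rewrite -linearD; congr (F (_, _)); rewrite ?addr0 ?add0r.
  have GE a : G a = F (L a) by rewrite /L Fpair.
  have -> : F (y, s) = e G.
    have -> : e G = e (adjoint (transpose act) F1 y) + e (adjoint m F2 s).
      exact: linearD.
    by rewrite ey es Fpair.
  rewrite (le_trans (realify_dual_norm _ _))// mulrC ler_wpM2r//.
  by apply: realify_dual_norm_le => // a; rewrite GE.
move=> a [aM aL]; exists a; split=> //.
  by apply: le_trans aL; exact: (realify_norm_fst ((y, s) - L a)).
by apply: le_trans aL; exact: (realify_norm_snd ((y, s) - L a)).
Qed.

Theorem factorization_of_bidual_unit A X (m : bbilinear A A A)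
    (act : bbilinear A X X) (e : dual (dual A)) :
    geometrically_complete (realify A) -> geometrically_complete (realify X) ->
    (forall a b x, act (m a b) x = act a (act b x)) ->
    (forall F y, e (adjoint (transpose act) F y) = F y) ->
    (forall F s, e (adjoint m F s) = F s) ->
  forall x, exists a y, act a y = x.
Proof.
move=> Ac Xc actM ey es; have [C C0 actB] := bbil_real_bound act.
apply: (@cohen_factorization R (realify A) (realify X) m act C
  (`|e : realify (dual (dual A))| + 1)) => //.
- exact: bbil_real_bilinear.
- by rewrite addr_ge0.
- exact: bounded_approximate_unit.
Qed.

End WeakUnits.

(** * Associativity of the Arens extensions *)

Section ArensAssociativity.
Context {R : realType} {c : scalar_kind}.

(** Both sides unfold to the same iterated evaluation, of [x''], then [y''],
    then [z'']. *)
Lemma adjoint3_assoc (X Y Z U V W : normedModType (scalars R c))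
    (f : bbilinear X Y U) (g : bbilinear U Z W)
    (h : bbilinear Y Z V) (l : bbilinear X V W) :
    (forall x y z, g (f x y) z = l x (h y z)) ->
  forall x y z, adjoint3 g (adjoint3 f x y) z = adjoint3 l x (adjoint3 h y z).
Proof.
move=> fghl x'' y'' z''; apply: dual_ext => w' /=; congr (x'' _).
apply: dual_ext => x /=; congr (y'' _).
apply: dual_ext => y /=; congr (z'' _).
by apply: dual_ext => z /=; rewrite fghl.
Qed.

Context (A : banachAlgebra R c) (B : banachBimodule A).

Lemma left_actA k a a' b :
  left_act B k (arens_mul A k a a') b = left_act B k a (left_act B k a' b).
Proof.
elim: k a a' b => [|k IH] /=; first exact: bbim_leftA.
exact: adjoint3_assoc.
Qed.

Lemma right_actA k b a a' :
  right_act B k b (arens_mul A k a a') = right_act B k (right_act B k b a) a'.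
Proof.
elim: k b a a' => [|k IH] /=; first exact: bbim_rightA.
by move=> b a a'; symmetry; apply: adjoint3_assoc => x y z; rewrite IH.
Qed.

Lemma dual_left_actA k a a' b' :
  dual_left_act B k (arens_mul A k a a') b' =
  dual_left_act B k a (dual_left_act B k a' b').
Proof. by apply: dual_ext => b; rewrite !dual_left_actE right_actA. Qed.

Lemma dual_right_actA k b' a a' :
  dual_right_act B k b' (arens_mul A k a a') =
  dual_right_act B k (dual_right_act B k b' a) a'.
Proof. by apply: dual_ext => b; rewrite !dual_right_actE left_actA. Qed.

Lemma iter_dual_complete k (X : completeNormedModType (scalars R c)) :
  geometrically_complete (realify (iter_dual k X)).
Proof. by case: k => [|k]; [exact: complete_realify|exact: complete_dual]. Qed.

End ArensAssociativity.

(** * Weak* approximation of bidual elements *)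

Section WeakConvergence.
Context {R : realType} {c : scalar_kind}.
Local Notation K := (scalars R c).
Implicit Types (X : normedModType K).

Lemma cvg_initialP (I : Type) (S : choiceType) (T : topologicalType)
    (f : S -> T) (F : set_system I) (g : I -> S) (s : S) : Filter F ->
  ((g i : initial_topology f) @[i --> F] --> (s : initial_topology f)) <->
  (f (g i) @[i --> F] --> f s).
Proof.
move=> FF; split=> [gs|gs].
  exact: (cvg_comp _ _ gs (@initial_continuous _ _ f s)).
move=> U /= [_ [[V oV <-] Vs VU]].
have /gs : nbhs (f s) V by exact: open_nbhs_nbhs.
move=> FV.
exact: (@filterS _ F _ ((f \o g) @^-1` V) (g @^-1` U) (fun i => VU (g i))).
Qed.

Lemma cvg_weak_starP (I : Type) X (F : set_system I) (g : I -> dual X)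
    (f : dual X) : Filter F ->
  ((g i : weak_star X) @[i --> F] --> (f : weak_star X)) <->
  (forall x, g i x @[i --> F] --> f x).
Proof.
move=> FF; rewrite cvg_initialP.
have := @pointwise_cvgP X K^o (fmap (fun i => g i : X -> K^o) F) f.
exact.
Qed.

Lemma cvg_weakP (I : Type) X (F : set_system I) (g : I -> X) (x : X) :
    Filter F ->
  ((g i : weak X) @[i --> F] --> (x : weak X)) <->
  (forall f : dual X, f (g i) @[i --> F] --> f x).
Proof.
move=> FF; rewrite cvg_initialP.
have := @pointwise_cvgP (dual X) K^o
  (fmap (fun i => (fun f : dual X => f (g i)) : dual X -> K^o) F)
  (fun f : dual X => f x).
exact.
Qed.

Lemma dualB X (f : dual X) x y : f (x - y) = f x - f y.
Proof. exact: linearB. Qed.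

Lemma dualZ X (f : dual X) (r : K) x : f (r *: x) = r * f x.
Proof. exact: linearZ. Qed.

(** Such an [f] is a linear combination of [s]: some multiple of the head [g] can
    be subtracted from [f] so that the difference vanishes on the common kernel
    of the tail. *)
Lemma vanish_on_kernel X (s : seq (dual X)) (f : dual X) :
    (forall x, (forall g, g \in s -> g x = 0) -> f x = 0) ->
  forall e : dual (dual X), (forall g, g \in s -> e g = 0) -> e f = 0.
Proof.
elim: s f => [|g s IH] f fs e es.
  have -> : f = 0 by apply: dual_ext => x; exact: fs.
  exact: linear0.
have es' h : h \in s -> e h = 0 by move=> hs; rewrite es// inE hs orbT.
have [[n [ns gn]]|nex] :=
  pselect (exists n, (forall h, h \in s -> h n = 0) /\ g n != 0).
  have : e (f - (f n / g n) *: g) = 0.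
    apply: IH es' => x xs.
    have <- : f (x - (g x / g n) *: n) = 0.
      apply: fs => h; rewrite inE => /orP[/eqP->|hs].
        by rewrite dualB dualZ divfK// subrr.
      by rewrite dualB dualZ (xs h)// (ns h)// mulr0 subrr.
    rewrite dualB dualZ -[LHS]/(f x - f n / g n * g x); congr (_ - _).
    by rewrite mulrAC [RHS]mulrAC [f n * _]mulrC.
  by rewrite dualB dualZ (es g) ?mem_head// mulr0 subr0.
apply: IH es' => x xs; apply: fs => h; rewrite inE => /orP[/eqP->|]; last exact: xs.
by apply/eqP/negPn/negP => gx; apply: nex; exists x.
Qed.

(** If [f] does not vanish on the common kernel of [s], move [x] inside that
    kernel; otherwise the value at [f] is forced by those on [s]. *)
Lemma finite_interpolation X (e : dual (dual X)) (s : seq (dual X)) :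
  exists x, forall f, f \in s -> f x = e f.
Proof.
elim: s => [|f s [x xs]]; first by exists 0.
have [[n [ns fn]]|nex] :=
  pselect (exists n, (forall h, h \in s -> h n = 0) /\ f n != 0).
  exists (x - ((f x - e f) / f n) *: n) => h; rewrite inE => /orP[/eqP->|hs].
    by rewrite dualB dualZ divfK// subKr.
  by rewrite dualB dualZ (ns h)// mulr0 subr0 xs.
exists x => h; rewrite inE => /orP[/eqP->|]; last exact: xs.
have : (e - bidual_embed x) f = 0.
  apply: (@vanish_on_kernel _ s) => [y ys|g gs].
    by apply/eqP/negPn/negP => fy; apply: nex; exists y.
  by rewrite -[LHS]/(e g - g x) xs// subrr.
by rewrite -[X in X = _ -> _]/(e f - f x) => /eqP; rewrite subr_eq0 => /eqP.
Qed.

(** Every element of the bidual is the weak* limit of a filter on the space,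
    along which each functional is eventually constant. *)
Lemma exists_interpolating_filter X (e : dual (dual X)) :
  exists2 F : set_system X, ProperFilter F &
    forall f : dual X, \forall x \near F, f x = e f.
Proof.
pose F : set_system X :=
  [set S | exists s : seq (dual X),
    forall x, (forall f, f \in s -> f x = e f) -> S x].
exists F; last by move=> f; exists [:: f] => x; apply; rewrite mem_head.
split.
  by move=> [s sP]; have [x xs] := finite_interpolation e s; exact: (sP x xs).
split.
- by exists [::].
- move=> P Q [s sP] [t tQ]; exists (s ++ t) => x xst; split.
    by apply: sP => f fs; apply: (xst); rewrite mem_cat fs.
  by apply: tQ => f ft; apply: (xst); rewrite mem_cat ft orbT.
- by move=> P Q PQ [s sP]; exists s => x /sP /PQ.
Qed.

Lemma interpolating_cvg_weak_star X (e : dual (dual X)) (F : set_system X) :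
    ProperFilter F -> (forall f : dual X, \forall x \near F, f x = e f) ->
  (bidual_embed x : weak_star (dual X)) @[x --> F] --> (e : weak_star (dual X)).
Proof.
by move=> FF Fe; apply/cvg_weak_starP => f; apply: cvg_near_cst; exact: Fe.
Qed.

End WeakConvergence.

Lemma closure_of_cvg (I : Type) (T : topologicalType) (F : set_system I)
    (g : I -> T) (x : T) (S : set T) : ProperFilter F ->
  (forall i, S (g i)) -> g i @[i --> F] --> x -> closure S x.
Proof.
move=> FF Sg gx U /gx FU.
by have [i Ui] := @filter_ex _ F _ (g @^-1` U) FU; exists (g i).
Qed.

(** * Units of the even duals *)

Section Units.
Context {R : realType} {c : scalar_kind} (A : banachAlgebra R c)
  (B : banachBimodule A) (k : nat).
Local Notation A0 := (iter_dual k.*2 A).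
Local Notation B0 := (iter_dual k.*2 B).
Implicit Types (e : dual (dual A0)).

Lemma right_act_embed (b : dual (dual B0)) (a : A0) (b' : dual B0) :
  right_act B k.+1 b (bidual_embed a) b' = b (dual_left_act B k a b').
Proof. by apply: (congr1 b); exact: dual_ext. Qed.

(** The unit laws at elements of the preduals; the law for the module is used at
    every [F] in the bidual, since the first Arens extension of the left action
    evaluates [e] last. *)
Lemma left_unit_bidual e : left_unit B k.+1 e ->
  (forall (F : dual A0) s, e (adjoint (transpose (arens_mul A k)) F s) = F s) /\
  (forall (F : dual (dual B0)) b', e (adjoint (dual_right_act B k) F b') = F b').
Proof.
move=> [eA eB]; split=> [F s|F b'].
  have /(congr1 (fun a : dual (dual A0) => a F)) := eA (bidual_embed s).
  by move=> /= E; rewrite -[RHS]E; congr (e _); exact: dual_ext.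
have /(congr1 (fun b : dual (dual B0) => b b')) := eB F.
by move=> /= E; rewrite -[RHS]E; congr (e _); exact: dual_ext.
Qed.

Lemma right_unit_bidual e : right_unit B k.+1 e ->
  forall (F : dual A0) s, e (adjoint (arens_mul A k) F s) = F s.
Proof.
move=> [eA _] F s.
by have /(congr1 (fun a : dual (dual A0) => a F)) := eA (bidual_embed s).
Qed.

(** Evaluations at points of the predual are among the functionals that define
    the weak topology. *)
Lemma Zl_tilde_sub e : Zl_tilde B k e `<=` Zl B k e.
Proof.
move=> b /point_continuousP be; apply/point_continuousP.
have eF : Filter (nbhs (e : weak_star (dual A0))) by exact: nbhs_filter.
apply: (cvg_weak_starP (right_act B k.+1 b) (right_act B k.+1 b e) eF).2 => b'.
exact: ((cvg_weakP (right_act B k.+1 b) (right_act B k.+1 b e) eF).1 be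
  (bidual_embed b')).
Qed.

(** Along the filter the number [(F a) b' = F (a b')] is eventually
    [e (a |-> F (a b'))], while by continuity it tends to [(F e) b' = F b']. *)
Lemma Zl_right_unit_act e : right_unit B k.+1 e -> Zl B k e = setT ->
  forall (F : dual (dual B0)) b',
    e (adjoint (transpose (dual_left_act B k)) F b') = F b'.
Proof.
move=> [_ eB] ZT F b'.
have /point_continuousP Fc : Zl B k e F by rewrite ZT.
have [G GF Ge] := exists_interpolating_filter e.
have Gw := interpolating_cvg_weak_star GF Ge.
have := cvg_comp _ _ Gw Fc; rewrite eB => /cvg_weak_starP /(_ b').
have /cvg_near_cst : \forall a \near G,
    right_act B k.+1 F (bidual_embed a) b' =
    e (adjoint (transpose (dual_left_act B k)) F b').
  near=> a; rewrite right_act_embed.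
  by near: a; exact: (Ge (adjoint (transpose (dual_left_act B k)) F b')).
by move=> c1 c2; exact: (cvg_unique _ c1 c2).
Unshelve. all: by end_near. Qed.

Lemma dual_left_act_onto e : right_unit B k.+1 e ->
    (forall (F : dual (dual B0)) b',
      e (adjoint (transpose (dual_left_act B k)) F b') = F b') ->
  [set dual_left_act B k a b' | a in setT & b' in setT] = setT.
Proof.
move=> eu eB; apply/seteqP; split=> // x _.
have [] := @factorization_of_bidual_unit R c A0 (dual B0) (arens_mul A k)
  (dual_left_act B k) e _ _ _ eB (right_unit_bidual eu) x.
- exact: iter_dual_complete.
- exact: complete_dual.
- exact: dual_left_actA.
by move=> a [y <-]; exists a => //; exists y.
Qed.

Lemma dual_right_act_onto e : left_unit B k.+1 e ->
  [set dual_right_act B k b' a | b' in setT & a in setT] = setT.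
Proof.
move=> /left_unit_bidual[eA eB]; apply/seteqP; split=> // x _.
have {}eB (F : dual (dual B0)) b' :
    e (adjoint (transpose (transpose (dual_right_act B k))) F b') = F b'.
  by rewrite -eB; congr (e _); exact: dual_ext.
have [] := @factorization_of_bidual_unit R c A0 (dual B0)
  (transpose (arens_mul A k)) (transpose (dual_right_act B k)) e _ _ _ eB eA x.
- exact: iter_dual_complete.
- exact: complete_dual.
- by move=> a b y; exact: dual_right_actA.
by move=> a [y <-]; exists y => //; exists a.
Qed.

Lemma dual_left_act_dense e : right_unit B k.+1 e -> Zl_tilde B k e = setT ->
  @closure (weak_star (iter_dual k.+1.*2 B))
    [set dual_left_act B k.+1 (even_embed a) b' | a in setT & b' in setT] = setT.
Proof.
move=> [_ eB] ZT; apply/seteqP; split=> // b' _.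
have [G GF Ge] := exists_interpolating_filter e.
have Gw := interpolating_cvg_weak_star GF Ge.
apply: (@closure_of_cvg _ (weak_star (iter_dual k.+1.*2 B)) G
  (fun a => dual_left_act B k.+1 (even_embed a) b')) => [a|].
  by exists a => //; exists b'.
apply/cvg_weak_starP => b.
have /point_continuousP bc : Zl_tilde B k e b by rewrite ZT.
by have := cvg_comp _ _ Gw bc; rewrite eB => /cvg_weakP /(_ b').
Qed.

Lemma dual_right_act_dense e : left_unit B k.+1 e -> Zr_tilde B k e = setT ->
  @closure (weak_star (iter_dual k.+1.*2 B))
    [set dual_right_act B k.+1 b' (even_embed a) | b' in setT & a in setT] = setT.
Proof.
move=> [_ eB] ZT; apply/seteqP; split=> // b' _.
have [G GF Ge] := exists_interpolating_filter e.
have Gw := interpolating_cvg_weak_star GF Ge.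
apply: (@closure_of_cvg _ (weak_star (iter_dual k.+1.*2 B)) G
  (fun a => dual_right_act B k.+1 b' (even_embed a))) => [a|].
  by exists b' => //; exists a.
apply/cvg_weak_starP => b.
have /point_continuousP bc : Zr_tilde B k e b by rewrite ZT.
by have := cvg_comp _ _ Gw bc; rewrite eB => /cvg_weakP /(_ b').
Qed.

End Units.

Theorem mainTheorem5 (R : realType) (c : scalar_kind) (A : banachAlgebra R c)
    (B : banachBimodule A) (k : nat) :
  (* n = k.+1.*2 *)
  [/\ forall e : iter_dual k.+1.*2 A,
        right_unit B k.+1 e -> Zl B k e = setT ->
        [set dual_left_act B k a b' | a in setT & b' in setT] = setT,
      forall e : iter_dual k.+1.*2 A,
        left_unit B k.+1 e -> Zr B k e = setT ->
        [set dual_right_act B k b' a | b' in setT & a in setT] = setT,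
      forall e : iter_dual k.+1.*2 A,
        right_unit B k.+1 e -> Zl_tilde B k e = setT ->
        [set dual_left_act B k a b' | a in setT & b' in setT] = setT /\
        @closure (weak_star (iter_dual k.+1.*2 B))
          [set dual_left_act B k.+1 (even_embed a) b'
            | a in setT & b' in setT] = setT
    & forall e : iter_dual k.+1.*2 A,
        left_unit B k.+1 e -> Zr_tilde B k e = setT ->
        [set dual_right_act B k b' a | b' in setT & a in setT] = setT /\
        @closure (weak_star (iter_dual k.+1.*2 B))
          [set dual_right_act B k.+1 b' (even_embed a)
            | b' in setT & a in setT] = setT].
Proof.
split=> [e eu eZ|e eu _|e eu eZ|e eu eZ].
- exact: dual_left_act_onto eu (Zl_right_unit_act eu eZ).
- exact: dual_right_act_onto eu.
- split; last exact: (dual_left_act_dense eu eZ).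
  apply: dual_left_act_onto eu (Zl_right_unit_act eu _).
  by apply/seteqP; split=> // b _; apply: Zl_tilde_sub; rewrite eZ.
- by split; [exact: dual_right_act_onto eu|exact: (dual_right_act_dense eu eZ)].
Qed.
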